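(* Let $n\geq 1$ be an integer and let $\mathsf{sa}_{2n+1}$ be the mould whose length-one component is $\mathsf{sa}_{2n+1}^1(u)=u^{2n}$ and whose components of every other length are $0$. Then for every $d\geq 1$, \[ \psi_{2n+1}^{(d)}(x_1,\,x_1+x_2,\,\dots,\,x_1+x_2+\cdots+x_d)=\bigl(\mathsf{sang}(\mathsf{sa}_{2n+1})\bigr)^{d}(x_1,\dots,x_d), \] i.e. $\psi_{2n+1}^\sharp=\mathsf{sang}(\mathsf{sa}_{2n+1})$, where $f^\sharp(x_1,\dots,x_d):=f(x_1,x_1+x_2,\dots,x_1+\cdots+x_d)$.
   Context: Moulds. For $m\geq0$ let $\mathcal F_m=\mathbb{Q}((x_1,\dots,x_m))$ be the fraction field of $\mathbb{Q}[[x_1,\dots,x_m]]$. A mould is a family $M=(M^m(x_1,\dots,x_m))_{m\ge0}$ with $M^m\in\mathcal F_m$. For a word $\omega=(w_1,\dots,w_m)$ of $\mathbb{Z}$-linear combinations of variables, write $M(\omega):=M^m(w_1,\dots,w_m)$. The product is $(M\times N)^m(x_1,\dots,x_m)=\sum_{k=0}^m M^k(x_1,\dots,x_k)N^{m-k}(x_{k+1},\dots,x_m)$, with unit $1$ ($1$ in length $0$, $0$ otherwise). $\mathsf{ARI}$ denotes moulds with $M^0=0$; $\mathsf{GARI}$ denotes moulds with $M^0=1$ (a group under $\times$, inverse $T^{\times-1}$). Flexions: for nonempty words $\alpha=(a_1,\dots,a_m)$, $\beta=(b_1,\dots,b_n)$ put $\lceil\beta\rceil\alpha:=(b_1+\cdots+b_n+a_1,a_2,\dots,a_m)$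 and $\alpha\lfloor\beta\rfloor:=(a_1,\dots,a_{m-1},a_m+b_1+\cdots+b_n)$; also $\lceil\emptyset\rceil\gamma=\gamma\lfloor\emptyset\rfloor=\gamma$ and $\lceil\gamma\rceil\emptyset=\emptyset\lfloor\gamma\rfloor=\emptyset$. For $b$ nonempty, $\lceil a\rceil b\lfloor c\rfloor$ means $b$ with its first entry increased by the sum of the entries of $a$ and its last entry increased by the sum of the entries of $c$. $\mathsf{arit}(N)(M)$ is $0$ in lengths $0,1$ and for $m\ge2$ equals $\sum_{(x_1,\dots,x_m)=\alpha\beta\gamma,\ \beta,\gamma\ne\emptyset}M(\alpha\,\lceil\beta\rceil\gamma)N(\beta)-\sum_{(x_1,\dots,x_m)=\alpha\beta\gamma,\ \alpha,\beta\ne\emptyset}M(\alpha\lfloor\beta\rfloor\,\gamma)N(\beta)$. $\mathsf{preari}(M,N)=\mathsf{arit}(N)(M)+M\times N$; $\mathsf{preari}_0(A)=1$, $\mathsf{preari}_1(A)=A$, $\mathsf{preari}_n(A)=\mathsf{preari}(\mathsf{preari}_{n-1}(A),A)$; $\mathsf{expari}(A)=\sum_{n\ge0}\frac1{n!}\mathsf{preari}_n(A)$, a bijection $\mathsf{ARI}\to\mathsf{GARI}$ with inverse $\mathsf{logari}$. For $S,T\in\mathsf{GARI}$: $\mathsf{garit}(T)(S)$ is $1$ in length $0$ and for $m\ge1$ equals $\sum_{s\ge1}\sum S(\lceil a_1\rceil b_1\lfloor c_1\rfloor\cdots\lceil a_s\rceil b_s\lfloor c_s\rfloor)T(a_1)\cdots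 T(a_s)T^{\times-1}(c_1)\cdots T^{\times-1}(c_s)$, the inner sum over factorizations $(x_1,\dots,x_m)=a_1b_1c_1\cdots a_sb_sc_s$ with all $b_i\ne\emptyset$ and $c_ia_{i+1}\neq\emptyset$ ($1\le i<s$). $\mathsf{gari}(S,T)=\mathsf{garit}(T)(S)\times T$ makes $\mathsf{GARI}$ a group; $\mathsf{invgari}(S)$ is the inverse. $\mathsf{adari}(S)(A):=\mathsf{logari}(\mathsf{gari}(\mathsf{gari}(S,\mathsf{expari}(A)),\mathsf{invgari}(S)))$. $\mathsf{neg}(M)^m(x_1,\dots,x_m)=M^m(-x_1,\dots,-x_m)$. $\mathsf{paj}\in\mathsf{GARI}$: $\mathsf{paj}^m(x_1,\dots,x_m)=\frac{1}{x_1(x_1+x_2)\cdots(x_1+\cdots+x_m)}$. The singulator: $\mathsf{sang}(M):=\frac12(\mathrm{id}+\mathsf{neg}\circ\mathsf{adari}(\mathsf{paj}))(\mathsf{paj}^{\times-1}\times M\times\mathsf{paj})$. Brown's element: with $x_0=0$ and, for index sets $A,B$, $x_{A,B}=\prod_{a\in A,b\in B}(x_a-x_b)$ ($=1$ if $A$ or $B$ is empty), $\psi^{(d)}_{2n+1}(x_1,\dots,x_d)=\frac12\sum_{i=1}^d\Big(\frac{(x_i-x_{i-1})^{2n}}{x_{\{0,\dots,i-2\},\{i-1\}}\,x_{\{i+1,\dots,d\},\{i\}}}+\frac{x_d^{2n}}{x_{\{1,\dots,i-1\},\{0\}}\,x_{\{i,\dots,d-1\},\{d\}}}\Big)-\frac12\sum_{i=1}^{d-1}\Big(\frac{(x_1-x_d)^{2n}}{x_{\{2,\dots,i\},\{1\}}\,x_{\{i+1,\dots,d-1,0\},\{d\}}}+\frac{x_{d-1}^{2n}}{x_{\{d,1,\dots,i-1\},\{0\}}\,x_{\{i,\dots,d-2\},\{d-1\}}}\Big)$,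 where sets like $\{a,\dots,b\}$ with $b<a$ are empty (extra listed elements remaining). *)

(* Defs.v *)
From HB Require Import structures.
From mathcomp Require Import all_boot all_order all_algebra.
From mathcomp Require Import fraction.
From mathcomp Require Import mpoly.
From Stdlib Require Import ClassicalEpsilon.
Set Implicit Arguments. Unset Strict Implicit. Unset Printing Implicit Defensive.
Import Order.TTheory GRing.Theory Num.Theory.
Local Open Scope ring_scope.

(* Moulds.  A mould M over a field L is modelled by its action on words:    *)
(*   M w := M^(size w)(w_1,...,w_m)   for a word w = [:: w_1; ...; w_m].     *)
Section Moulds.
Variable L : fieldType.

Definition mould := seq L -> L.

Definition wsum (w : seq L) : L := \sum_(x <- w) x.

Definition mone : mould := fun w => if w is [::] then 1 else 0.

Definition in_ARI (M : mould) : Prop := M [::] = 0.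
Definition in_GARI (M : mould) : Prop := M [::] = 1.

Definition madd (M N : mould) : mould := fun w => M w + N w.
Definition mscale (c : L) (M : mould) : mould := fun w => c * M w.

Definition mmul (M N : mould) : mould :=
  fun w => \sum_(k < (size w).+1) M (take k w) * N (drop k w).

Definition minv (T : mould) : mould :=
  epsilon (inhabits mone) (fun U => in_GARI U /\ mmul T U = mone).

Definition lflex (b a : seq L) : seq L :=
  if a is x :: a' then (wsum b + x) :: a' else [::].
Definition rflex (a b : seq L) : seq L := rev (lflex b (rev a)).
Definition mflex (a b c : seq L) : seq L := rflex (lflex a b) c.

Definition seg (w : seq L) (i j : nat) : seq L := take (j - i) (drop i w).

Definition arit (N M : mould) : mould := fun w =>
  let m := size w in
  if (m < 2)%N then 0 else
  \sum_(i < m.+1) \sum_(j < m.+1 | ((i < j) && (j < m))%N)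
      M (take i w ++ lflex (seg w i j) (drop j w)) * N (seg w i j)
  - \sum_(i < m.+1) \sum_(j < m.+1 | ((0 < i) && (i < j))%N)
      M (rflex (take i w) (seg w i j) ++ drop j w) * N (seg w i j).

Definition preari (M N : mould) : mould := madd (arit N M) (mmul M N).

Fixpoint preari_pow (A : mould) (n : nat) : mould :=
  match n with
  | 0 => mone
  | 1 => A
  | (n'.+1) as k => preari (preari_pow A n') A
  end.

(* expari A = sum_n preari_n(A)/n!; for A in ARI the length-m component of
   preari_n(A) vanishes for n > m, so the series is truncated at n = m. *)
Definition expari (A : mould) : mould := fun w =>
  \sum_(k < (size w).+1) (k`!%:R)^-1 * preari_pow A k w.

Definition logari (S : mould) : mould :=
  epsilon (inhabits (fun _ => 0)) (fun A => in_ARI A /\ expari A = S).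

Fixpoint splits (k : nat) (w : seq L) : seq (seq (seq L)) :=
  match k with
  | 0 => if w is [::] then [:: [::]] else [::]
  | k'.+1 => flatten [seq [seq take i w :: p | p <- splits k' (drop i w)]
                     | i <- iota 0 (size w).+1]
  end.

(* for a factorization p = [a_1; b_1; c_1; ...; a_s; b_s; c_s] *)
Definition fa (p : seq (seq L)) (i : nat) := nth [::] p (3 * i).
Definition fb (p : seq (seq L)) (i : nat) := nth [::] p (3 * i).+1.
Definition fc (p : seq (seq L)) (i : nat) := nth [::] p (3 * i).+2.

Definition garit_ok (s : nat) (p : seq (seq L)) : bool :=
  all (fun i => fb p i != [::]) (iota 0 s) &&
  all (fun i => fc p i ++ fa p i.+1 != [::]) (iota 0 s.-1).

Definition garit (T S : mould) : mould := fun w =>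
  if w is [::] then 1 else
  \sum_(s < (size w).+1 | (0 < s)%N) \sum_(p <- splits (3 * s) w | garit_ok s p)
     S (flatten [seq mflex (fa p i) (fb p i) (fc p i) | i <- iota 0 s])
     * (\prod_(i < s) T (fa p i)) * (\prod_(i < s) minv T (fc p i)).

Definition gari (S T : mould) : mould := mmul (garit T S) T.

Definition invgari (S : mould) : mould :=
  epsilon (inhabits mone) (fun T => in_GARI T /\ gari S T = mone).

Definition adari (S A : mould) : mould :=
  logari (gari (gari S (expari A)) (invgari S)).

Definition mneg (M : mould) : mould := fun w => M (map -%R w).

Definition paj : mould := fun w =>
  \prod_(i < size w) (\sum_(j < i.+1) nth 0 w j)^-1.

Definition sang (M : mould) : mould :=
  let N := mmul (mmul (minv paj) M) paj in
  mscale (2%:R^-1) (madd N (mneg (adari paj N))).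

Definition sa (n : nat) : mould := fun w => if w is [:: u] then u ^+ (2 * n) else 0.

(* Brown's element psi^{(d)}_{2n+1}(x_1..x_d), with x_0 = 0. *)
Definition rng (a b1 : nat) : seq nat := iota a (b1 - a).

Definition psi (n : nat) (xs : seq L) : L :=
  let d := size xs in
  let x k := if k == 0%N then 0 else nth 0 xs k.-1 in
  let xAB (A B : seq nat) := \prod_(a <- A) \prod_(b <- B) (x a - x b) in
  2%:R^-1 * \sum_(1 <= i < d.+1)
     ( (x i - x i.-1) ^+ (2 * n) / (xAB (rng 0 i.-1) [:: i.-1] * xAB (rng i.+1 d.+1) [:: i])
     + x d ^+ (2 * n) / (xAB (rng 1 i) [:: 0%N] * xAB (rng i d) [:: d]) )
  - 2%:R^-1 * \sum_(1 <= i < d)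
     ( (x 1%N - x d) ^+ (2 * n) / (xAB (rng 2 i.+1) [:: 1%N] * xAB (rng i.+1 d ++ [:: 0%N]) [:: d])
     + x d.-1 ^+ (2 * n) / (xAB (d :: rng 1 i) [:: 0%N] * xAB (rng i d.-1) [:: d.-1]) ).

Definition psums (w : seq L) : seq L :=
  [seq \sum_(j < i.+1) nth 0 w j | i <- iota 0 (size w)].

End Moulds.

Definition genvars (d : nat) : seq {fraction {mpoly rat[d]}} :=
  [seq tofrac ('X_i : {mpoly rat[d]}) | i <- enum 'I_d].

(* Main.v *)
Require Import Defs.
From HB Require Import structures.
From mathcomp Require Import all_boot all_order all_algebra.
From mathcomp Require Import fraction mpoly.
From mathcomp Require Import ring zify.
From Stdlib Require Import ClassicalEpsilon FunctionalExtensionality.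
Set Implicit Arguments. Unset Strict Implicit. Unset Printing Implicit Defensive.
Import Order.TTheory GRing.Theory Num.Theory.
Local Open Scope ring_scope.

(* Let x be the mould product, I the mould equal to 1 on letters, and o the
   mould composition (S o K)(w) = sum over w = w_1...w_r of
   S(|w_1|,...,|w_r|) K(w_1)...K(w_r), where |u| is the sum of the letters of u.
   Then garit(T)(S) = S o K_T with K_T = T x I x T^-1, and arit(A) is the
   derivation of x sending I to A x I - I x A.  Hence gari is associative, and
   comparing the differential equations satisfied by the flows t -> expari(tA),
   Q = adari(S)(A) is characterised by (Q o K_S) x S = preari(S, A).

   Let nabla be the derivation M(w) |-> |w| M(w).  The mould S = paj solves
   nabla S = S x I = K_S x S, so (neg S o K_S) x S is killed by nabla, hence is
   the unit; it follows that neg K_S is the inverse of K_S for o.  With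
   s = sa_{2n+1} and A = S^-1 x s x S, both sides of
   preari(S, A) = (Q o K_S) x S then solve the same first order equation if
   nabla Q = nabla G + G x I - I x G, where G = s o neg K_S.  Since s is even,
   neg Q expands into the last three sums of psi, and A into the first one.

   All denominators are sums of letters.  They do not vanish on words whose
   letters are polynomials taking a positive value at (1,...,1), nor on the
   negatives of such words. *)

Lemma size_ind (T : Type) (P : seq T -> Prop) :
  (forall w, (forall u, (size u < size w)%N -> P u) -> P w) -> forall w, P w.
Proof.
move=> IH w; have [n le_n] := ubnP (size w).
elim: n w le_n => // n IHn w le_n; apply: IH => u lt_u.
by apply: IHn; apply: leq_trans lt_u _.
Qed.

(** * Mould product, mould composition and block derivations on words *)

Section WordFunctions.
Variables (V : nmodType) (R : comNzRingType).
Implicit Types (w u : seq V) (M N F S T K : seq V -> R) (c : R).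

Definition wt w : V := \sum_(x <- w) x.

Lemma wt_nil : wt [::] = 0. Proof. exact: big_nil. Qed.
Lemma wt_cons x w : wt (x :: w) = x + wt w. Proof. exact: big_cons. Qed.
Lemma wt_cat u w : wt (u ++ w) = wt u + wt w. Proof. exact: big_cat. Qed.

Definition zerom : seq V -> R := fun _ => 0.
Definition onem : seq V -> R := fun w => if w is [::] then 1 else 0.
Definition addm M N : seq V -> R := fun w => M w + N w.
Definition scm c M : seq V -> R := fun w => c * M w.
Definition subm M N : seq V -> R := fun w => M w - N w.
Definition lder (x : V) M : seq V -> R := fun w => M (x :: w).

(* The second factor may depend on the weight of the first block: with a
   constant family this is the mould product, and with K as first factor it is
   one step of the mould composition. *)
Definition bind F (G : V -> seq V -> R) : seq V -> R := fun w =>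
  \sum_(k < (size w).+1) F (take k w) * G (wt (take k w)) (drop k w).
Definition conv M N := bind M (fun _ => N).

Lemma bind_nil F G : bind F G [::] = F [::] * G 0 [::].
Proof. by rewrite /bind big_ord_recl big_ord0 addr0 /= wt_nil. Qed.

Lemma bind_cons F G x w : bind F G (x :: w) =
  F [::] * G 0 (x :: w) + bind (lder x F) (fun v => G (x + v)) w.
Proof.
rewrite /bind big_ord_recl /= wt_nil; congr (_ + _).
by apply: eq_bigr => i _; rewrite /= wt_cons.
Qed.

Lemma conv_nil M N : conv M N [::] = M [::] * N [::].
Proof. exact: bind_nil. Qed.

Lemma conv_cons M N x w :
  conv M N (x :: w) = M [::] * N (x :: w) + conv (lder x M) N w.
Proof. exact: bind_cons. Qed.

Lemma bindDl F F' G : bind (addm F F') G = addm (bind F G) (bind F' G).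
Proof.
apply: functional_extensionality => w; rewrite /addm /bind -big_split /=.
by apply: eq_bigr => i _; rewrite mulrDl.
Qed.

Lemma bindBl F F' G : bind (subm F F') G = subm (bind F G) (bind F' G).
Proof.
apply: functional_extensionality => w; rewrite /subm /bind -sumrB /=.
by apply: eq_bigr => i _; rewrite mulrBl.
Qed.

Lemma bindZl c F G : bind (scm c F) G = scm c (bind F G).
Proof.
apply: functional_extensionality => w; rewrite /scm /bind mulr_sumr /=.
by apply: eq_bigr => i _; rewrite mulrA.
Qed.

Lemma bindDr F G G' :
  bind F (fun v => addm (G v) (G' v)) = addm (bind F G) (bind F G').
Proof.
apply: functional_extensionality => w; rewrite /addm /bind -big_split /=.
by apply: eq_bigr => i _; rewrite mulrDr.
Qed.

Lemma bindBr F G G' :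
  bind F (fun v => subm (G v) (G' v)) = subm (bind F G) (bind F G').
Proof.
apply: functional_extensionality => w; rewrite /subm /bind -sumrB /=.
by apply: eq_bigr => i _; rewrite mulrBr.
Qed.

Lemma bindZr c F G : bind F (fun v => scm c (G v)) = scm c (bind F G).
Proof.
apply: functional_extensionality => w; rewrite /scm /bind mulr_sumr /=.
by apply: eq_bigr => i _; rewrite mulrCA.
Qed.

Lemma convDl M M' N : conv (addm M M') N = addm (conv M N) (conv M' N).
Proof. exact: bindDl. Qed.
Lemma convBl M M' N : conv (subm M M') N = subm (conv M N) (conv M' N).
Proof. exact: bindBl. Qed.
Lemma convDr M N N' : conv M (addm N N') = addm (conv M N) (conv M N').
Proof. exact: bindDr. Qed.
Lemma convBr M N N' : conv M (subm N N') = subm (conv M N) (conv M N').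
Proof. exact: bindBr. Qed.

Lemma lder_bind x F G : lder x (bind F G) =
  addm (scm (F [::]) (lder x (G 0))) (bind (lder x F) (fun v => G (x + v))).
Proof. by apply: functional_extensionality => w; rewrite /lder bind_cons. Qed.

(** Both sides run over the factorizations of [w] into three blocks; [H] always receives the weight
    of the first two together. *)
Lemma bindA F G H : bind (bind F G) H =
  bind F (fun v => bind (G v) (fun y => H (v + y))).
Proof.
apply: functional_extensionality => w.
elim: w F G H => [|x w IH] F G H; first by rewrite !bind_nil addr0 mulrA.
rewrite !bind_cons bind_nil lder_bind bindDl bindZl {1}/addm {1}/scm IH addrA.
congr (_ + _); first by rewrite add0r mulrDr mulrA; congr (_ + _ * bind _ _ w);
  apply: functional_extensionality => v; rewrite add0r.
congr (bind _ _ w); apply: functional_extensionality => v.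
by congr bind; apply: functional_extensionality => u; rewrite addrA.
Qed.

Lemma convA M N T : conv (conv M N) T = conv M (conv N T).
Proof. exact: bindA. Qed.

Lemma bind_zero G : bind zerom G = zerom.
Proof.
apply: functional_extensionality => w.
by rewrite /bind big1 // => i _; rewrite mul0r.
Qed.

Lemma conv_zeror M : conv M zerom = zerom.
Proof.
apply: functional_extensionality => w.
by rewrite /conv /bind big1 // => i _; rewrite mulr0.
Qed.

Lemma addm_zeror M : addm M zerom = M.
Proof. by apply: functional_extensionality => w; rewrite /addm addr0. Qed.

Lemma bind_onel G : bind onem G = G 0.
Proof.
apply: functional_extensionality => -[|x w].
  by rewrite bind_nil mul1r.
by rewrite bind_cons mul1r (_ : lder x onem = zerom) // bind_zero addr0.
Qed.

Lemma conv1l M : conv onem M = M. Proof. exact: bind_onel. Qed.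

Lemma conv1r M : conv M onem = M.
Proof.
apply: functional_extensionality => w; elim: w M => [|x w IH] M.
  by rewrite conv_nil mulr1.
by rewrite conv_cons IH mulr0 add0r.
Qed.

Lemma bind_eq_size F F' G G' w :
  (forall k, (k <= size w)%N -> F (take k w) * G (wt (take k w)) (drop k w)
     = F' (take k w) * G' (wt (take k w)) (drop k w)) ->
  bind F G w = bind F' G' w.
Proof. by move=> h; apply: eq_bigr => i _; apply: h; rewrite -ltnS. Qed.

(* K [::] = 0 makes the inner blocks strictly shorter. *)
Lemma bind_eq_short K G G' w : K [::] = 0 ->
  (forall v u, (size u < size w)%N -> G v u = G' v u) ->
  bind K G w = bind K G' w.
Proof.
move=> K0 h; apply: bind_eq_size => -[|k] le_k; first by rewrite take0 K0 !mul0r.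
by congr (_ * _); apply: h; rewrite size_drop; lia.
Qed.

(** Such a [Phi] is unitriangular for the filtration by length, although it need not be linear. *)
Definition local_perturbation (Phi : (seq V -> R) -> seq V -> R) :=
  forall T T' w, (forall u, (size u < size w)%N -> T u = T' u) ->
  Phi T w - T w = Phi T' w - T' w.

(** The iteration [T := N - (Phi T - T)] is stationary on words of length m after m + 1 steps, so
    its diagonal values solve the equation. *)
Lemma solve_triangular Phi N : local_perturbation Phi ->
  exists T, Phi T = N.
Proof.
move=> loc.
pose fix it n : seq V -> R := if n is n'.+1
  then fun w => N w - (Phi (it n') w - it n' w) else fun _ => 0.
have it_stable n m w : (size w < n)%N -> (size w < m)%N -> it n w = it m w.
  elim: n m w => // n IH [//|m] w lt_n lt_m /=; congr (_ - _).
  by apply: loc => u lt_u; apply: IH; [apply: leq_trans lt_u _|apply: leq_trans lt_u _].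
exists (fun w => it (size w).+1 w); apply: functional_extensionality => w.
have := @loc (fun w => it (size w).+1 w) (it (size w)) w.
have h u : (size u < size w)%N -> it (size u).+1 u = it (size w) u.
  by move=> lt_u; apply: it_stable.
move=> /(_ h) /eqP; rewrite subr_eq => /eqP ->.
by rewrite [it (size w).+1 w]/= addrC subrK.
Qed.

(** [conv T] minus the identity is convolution by [subm T onem], which vanishes on the empty word,
    so it sees its argument only on shorter words. *)
Lemma conv_right_inv T : T [::] = 1 -> exists U, U [::] = 1 /\ conv T U = onem.
Proof.
move=> T1; have [|U TU] := @solve_triangular (conv T) onem.
  move=> U U' w eqU; suff h N : conv T N w - N w = conv (subm T onem) N w.
    rewrite !h; apply: bind_eq_short => [|_ u]; last exact: eqU.
    by rewrite /subm T1 subrr.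
  by rewrite convBl /subm conv1l.
exists U; split=> //.
by have := congr1 (fun M => M [::]) TU; rewrite conv_nil T1 mul1r.
Qed.

Lemma conv_inv T : T [::] = 1 ->
  exists U, [/\ U [::] = 1, conv T U = onem & conv U T = onem].
Proof.
move=> T1; have [U [U1 TU]] := conv_right_inv T1.
have [W [_ UW]] := conv_right_inv U1; exists U; split=> //.
by rewrite -[in LHS](conv1r T) -UW -(convA T) TU conv1l.
Qed.

Lemma conv_invK T U U' : conv U T = onem -> conv T U' = onem -> U = U'.
Proof. by move=> UT TU; rewrite -(conv1r U) -TU -convA UT conv1l. Qed.

Definition unitI : seq V -> R := fun w => if w is [:: _] then 1 else 0.

Lemma lder_unitI x : lder x unitI = onem.
Proof. by apply: functional_extensionality => -[]. Qed.

Lemma bind_unitI G x w : bind unitI G (x :: w) = G x w.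
Proof.
rewrite bind_cons mul0r add0r lder_unitI bind_onel.
by rewrite addr0.
Qed.

Lemma unitI_conv_nil N : conv unitI N [::] = 0.
Proof. by rewrite conv_nil mul0r. Qed.

Lemma unitI_conv_cons N x w : conv unitI N (x :: w) = N w.
Proof. exact: bind_unitI. Qed.

(** The fuel [n] bounds the number of blocks; [size w] is enough once [K [::] = 0], because then
    only nonempty blocks contribute. The weight of each block is fed to [S] as its next letter
    through [lder]. *)
Fixpoint compn n S K w : R :=
  if w is [::] then S [::] else
  if n is n'.+1 then bind K (fun v => compn n' (lder v S) K) w else 0.
Definition mcomp S K w : R := compn (size w) S K w.

Lemma compn_comp n S K w : K [::] = 0 -> (size w <= n)%N ->
  compn n S K w = mcomp S K w.
Proof.
move=> K0; have [m] := ubnP (size w); elim: m n S w => // m IH n S [|x w] /=.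
  by case: n.
case: n => // n lt_m; rewrite ltnS => le_n; rewrite /mcomp /=.
apply: bind_eq_short => // v u; rewrite /= ltnS => le_u.
by rewrite !IH //; lia.
Qed.

Lemma comp_nil S K : mcomp S K [::] = S [::]. Proof. by []. Qed.

Lemma compE S K : K [::] = 0 -> mcomp S K =
  addm (scm (S [::]) onem) (bind K (fun v => mcomp (lder v S) K)).
Proof.
move=> K0; apply: functional_extensionality => -[|x w]; rewrite /addm /scm /=.
  by rewrite bind_nil K0 mul0r addr0 mulr1.
rewrite mulr0 add0r /mcomp /=; apply: bind_eq_short => // v u.
by rewrite ltnS => le_u; rewrite compn_comp.
Qed.

Lemma comp_cons S K x w : K [::] = 0 ->
  mcomp S K (x :: w) = bind K (fun v => mcomp (lder v S) K) (x :: w).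
Proof. by move=> K0; rewrite [in LHS]compE // /addm /scm /= mulr0 add0r. Qed.

Lemma comp_add S S' K : K [::] = 0 ->
  mcomp (addm S S') K = addm (mcomp S K) (mcomp S' K).
Proof.
move=> K0; apply: functional_extensionality => w.
elim/size_ind: w S S' => -[|x w] IH S S' //.
rewrite /addm !comp_cons //.
rewrite -[RHS]/(addm (bind _ _) (bind _ _) _) -bindDr.
by apply: bind_eq_short => // v u lt_u; rewrite -IH.
Qed.

Lemma comp_scm c S K : K [::] = 0 -> mcomp (scm c S) K = scm c (mcomp S K).
Proof.
move=> K0; apply: functional_extensionality => w.
elim/size_ind: w S => -[|x w] IH S //.
rewrite /scm !comp_cons //.
rewrite -[RHS]/(scm c (bind _ _) _) -bindZr.
by apply: bind_eq_short => // v u lt_u; rewrite -IH.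
Qed.

Lemma comp_zero K : K [::] = 0 -> mcomp zerom K = zerom.
Proof.
move=> K0; have -> : zerom = scm 0 zerom.
  by apply: functional_extensionality => w; rewrite /scm mul0r.
rewrite comp_scm //; apply: functional_extensionality => w.
by rewrite /scm !mul0r.
Qed.

Lemma comp_sub S S' K : K [::] = 0 ->
  mcomp (subm S S') K = subm (mcomp S K) (mcomp S' K).
Proof.
move=> K0; have subE M N : subm M N = addm M (scm (-1) N).
  by apply: functional_extensionality => w; rewrite /addm /scm /subm mulN1r.
by rewrite !subE comp_add // comp_scm.
Qed.

Lemma comp_one K : K [::] = 0 -> mcomp onem K = onem.
Proof.
move=> K0; rewrite compE //; apply: functional_extensionality => w.
rewrite /addm /scm mul1r (_ : bind _ _ w = 0) ?addr0 // /bind big1 // => i _.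
by rewrite comp_zero // mulr0.
Qed.

Lemma comp_unitIl K : K [::] = 0 -> mcomp unitI K = K.
Proof.
move=> K0; rewrite compE // (_ : (fun v => _) = fun v => onem).
  rewrite -/(conv K _) conv1r.
  by apply: functional_extensionality => w; rewrite /addm /scm mul0r add0r.
by apply: functional_extensionality => v; rewrite lder_unitI comp_one.
Qed.

Lemma comp_unitIr S : mcomp S unitI = S.
Proof.
apply: functional_extensionality => w; elim: w S => [|x w IH] S //.
by rewrite comp_cons // bind_unitI IH.
Qed.

(** Grouping letters into blocks does not change the weight of a prefix, so [G] is called with the
    same weight before and after composition. The induction peels off the first [K]-block. *)
Lemma comp_bind F G K : K [::] = 0 ->
  mcomp (bind F G) K = bind (mcomp F K) (fun v => mcomp (G v) K).
Proof.
move=> K0; apply: functional_extensionality => w.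
elim/size_ind: w F G => -[|x w] IH F G; first by rewrite comp_nil !bind_nil.
rewrite comp_cons // [mcomp F K]compE // bindDl bindZl bind_onel bindA.
rewrite /addm /scm comp_cons //.
rewrite -[F _ * _]/(scm (F [::]) (bind _ _) _) -bindZr.
rewrite -[RHS]/(addm (bind _ _) (bind _ _) _) -bindDr.
apply: bind_eq_short => // v u lt_u.
by rewrite lder_bind comp_add // comp_scm // /addm IH.
Qed.

Lemma comp_conv M N K : K [::] = 0 ->
  mcomp (conv M N) K = conv (mcomp M K) (mcomp N K).
Proof. exact: comp_bind. Qed.

Lemma mcompA S K H : K [::] = 0 -> H [::] = 0 ->
  mcomp (mcomp S K) H = mcomp S (mcomp K H).
Proof.
move=> K0 H0; apply: functional_extensionality => w.
elim/size_ind: w S => -[|x w] IH S //.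
rewrite [mcomp S K]compE // comp_add // comp_scm // comp_one // comp_bind //.
rewrite /addm /scm mulr0 add0r [RHS]comp_cons ?comp_nil //.
by apply: bind_eq_short; rewrite ?comp_nil // => v u lt_u; rewrite IH.
Qed.

Lemma comp_local S K K' w : K [::] = 0 -> K' [::] = 0 ->
  (forall u, (size u <= size w)%N -> K u = K' u) -> mcomp S K w = mcomp S K' w.
Proof.
move=> K0 K'0; elim/size_ind: w S => -[|x w] IH S // eqK.
rewrite !comp_cons //; apply: bind_eq_size => -[|k] le_k.
  by rewrite take0 K0 K'0 !mul0r.
congr (_ * _); first by apply: eqK; rewrite size_take_min geq_minr.
have lt : (size (drop k.+1 (x :: w)) < size (x :: w))%N.
  by rewrite size_drop; move: le_k => /=; lia.
by apply: IH => // u le_u; apply: eqK; lia.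
Qed.

(** Agreement with [unitI], the unit of composition, in lengths 0 and 1: this makes [K] invertible
    for composition. *)
Definition tangent_to_id K := K [::] = 0 /\ forall x, K [:: x] = 1.

(** In [mcomp K H w] the grouping into a single block gives [K [:: wt w] * H w = H w]; every other
    grouping sees [H] only on shorter words. *)
Lemma comp_right_inv K : tangent_to_id K ->
  exists H, tangent_to_id H /\ mcomp K H = unitI.
Proof.
case=> K0 K1.
(* Composition requires a zero constant term, which the unknown does not have in advance: [nz]
   removes it, and [scm (H [::]) onem] restores it so that the operator is unitriangular in length 0
   too. *)
pose nz H : seq V -> R := fun w => if w is [::] then 0 else H w.
have [|H KH] := @solve_triangular
  (fun H => addm (scm (H [::]) onem) (mcomp K (nz H))) unitI.
  move=> H H' [|x w] eqH; rewrite /addm /scm /=.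
    by rewrite !mulr1 ![H _ + _]addrC ![H' _ + _]addrC !addrK.
  have bind_last G (F : seq V -> R) : (F [::] = 0) ->
      bind F G (x :: w) = F (x :: w) * G (wt (x :: w)) [::]
       + \sum_(k < (size w).+1) F (take k (x :: w))
            * G (wt (take k (x :: w))) (drop k (x :: w)).
    by move=> F0; rewrite /bind big_ord_recr /= take_size drop_size addrC.
  rewrite !mulr0 !add0r !comp_cons // !bind_last //= !comp_nil /lder !K1.
  rewrite !mulr1 ![H _ + _]addrC ![H' _ + _]addrC !addrK.
  apply: eq_bigr => k _; case: k => -[|k] lt_k /=; first by rewrite !mul0r.
  congr (_ * _).
    by apply: eqH => /=; rewrite ltnS size_take_min; lia.
  apply: comp_local => // -[|y u] // le_u; apply: eqH => /=.
  move: le_u; rewrite /= size_drop; lia.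
have H0 : H [::] = 0.
  have := congr1 (fun M => M [::]) KH.
  by rewrite /addm /scm comp_nil K0 mulr1 addr0.
have nzH : nz H = H by apply: functional_extensionality => -[].
have KH' : mcomp K H = unitI.
  rewrite -KH nzH; apply: functional_extensionality => w.
  by rewrite /addm /scm H0 mul0r add0r.
exists H; split=> //; split=> // x.
have := congr1 (fun M => M [:: x]) KH'.
rewrite comp_cons // bind_cons H0 mul0r add0r bind_nil comp_nil /lder K1 mulr1.
by [].
Qed.

Lemma comp_inv K : tangent_to_id K ->
  exists H, [/\ tangent_to_id H, mcomp K H = unitI & mcomp H K = unitI].
Proof.
move=> tK; have [H [tH KH]] := comp_right_inv tK.
have [W [tW HW]] := comp_right_inv tH; exists H; split=> //.
have -> : K = W.
  case: tK tH tW => K0 _ [H0 _] [W0 _].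
  by rewrite -(comp_unitIr K) -HW -mcompA // KH comp_unitIl.
by [].
Qed.

(* The derivation replacing one block v by a letter of the same weight, with
   coefficient D v. *)
Fixpoint der D M w : R :=
  if w is x :: w' then der D (lder x M) w' + bind D (fun v => lder v M) w else 0.

Lemma derE D M : D [::] = 0 -> der D M =
  addm (bind unitI (fun v => der D (lder v M))) (bind D (fun v => lder v M)).
Proof.
move=> D0; apply: functional_extensionality => -[|x w]; rewrite /addm.
  by rewrite !bind_nil D0 !mul0r addr0.
by rewrite bind_unitI.
Qed.

Lemma lder_der D x M : lder x (der D M) =
  addm (der D (lder x M)) (lder x (bind D (fun v => lder v M))).
Proof. by []. Qed.

Lemma der_add D M N : der D (addm M N) = addm (der D M) (der D N).
Proof.
apply: functional_extensionality => w.
elim: w M N => [|x w IH] M N; first by rewrite /addm addr0.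
rewrite [LHS]/= -[lder x _]/(addm (lder x M) (lder x N)) IH.
rewrite -[fun v => lder v _]/(fun v => addm (lder v M) (lder v N)) bindDr.
by rewrite /addm addrACA.
Qed.

Lemma der_scm D c M : der D (scm c M) = scm c (der D M).
Proof.
apply: functional_extensionality => w.
elim: w M => [|x w IH] M; first by rewrite /scm mulr0.
rewrite [LHS]/= -[lder x _]/(scm c (lder x M)) IH.
rewrite -[fun v => lder v _]/(fun v => scm c (lder v M)) bindZr.
by rewrite /scm -mulrDr.
Qed.

(** After the replacement the block is a single letter, which lies entirely in one factor, and the
    weight seen by [G] is unchanged. *)
Lemma der_bind D F G : D [::] = 0 -> der D (bind F G) =
  addm (bind (der D F) G) (bind F (fun v => der D (G v))).
Proof.
move=> D0; apply: functional_extensionality => w.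
elim: w F G => [|x w IH] F G; first by rewrite /addm !bind_nil /= mul0r mulr0 addr0.
rewrite [LHS]/= lder_bind der_add der_scm {1}/addm {1}/scm IH.
rewrite (_ : (fun v => lder v (bind F G)) = (fun v =>
   addm (scm (F [::]) (lder v (G 0))) (bind (lder v F) (fun y => G (v + y)))));
   last by apply: functional_extensionality => v; rewrite lder_bind.
rewrite bindDr bindZr -bindA /addm /scm [bind (bind D _) G _]bind_cons bind_nil D0.
rewrite [bind (der D F) _ _]bind_cons [bind F _ (x :: w)]bind_cons lder_der bindDl.
rewrite /addm /=.
ring.
Qed.

Lemma der_conv D M N : D [::] = 0 ->
  der D (conv M N) = addm (conv (der D M) N) (conv M (der D N)).
Proof. exact: der_bind. Qed.

Lemma der_one D : der D onem = zerom.
Proof.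
apply: functional_extensionality => -[|x w] //=.
rewrite (_ : lder x onem = zerom) // (_ : (fun v => lder v onem) = fun v => zerom) //.
have z : zerom = scm 0 zerom.
  by apply: functional_extensionality => u; rewrite /scm mul0r.
by rewrite z der_scm bindZr /scm !mul0r addr0.
Qed.

Lemma der_unitI D : D [::] = 0 -> der D unitI = D.
Proof.
move=> D0; apply: functional_extensionality => -[|x w] //=.
rewrite lder_unitI der_one add0r (_ : (fun v => _) = fun v => onem).
  by rewrite -/(conv D _) conv1r.
by apply: functional_extensionality => v; rewrite lder_unitI.
Qed.

(** Chain rule: the hypothesis on [K] is the case [M = unitI], and the general case follows by
    peeling off the first block. *)
Lemma der_comp_conj D D' K M : D [::] = 0 -> D' [::] = 0 -> K [::] = 0 ->
  der D K = mcomp D' K -> der D (mcomp M K) = mcomp (der D' M) K.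
Proof.
move=> D0 D'0 K0 DK; apply: functional_extensionality => w.
elim/size_ind: w M => -[|x w] IH M //.
rewrite [mcomp M K]compE // der_add der_scm der_one der_bind //.
rewrite [der D' M]derE // comp_add // !comp_bind // comp_unitIl // DK.
rewrite /addm /scm mulr0 add0r addrC; congr (_ + _).
by apply: bind_eq_short => // v u lt_u; rewrite IH.
Qed.

End WordFunctions.

Arguments zerom {V R}.
Arguments onem {V R}.
Arguments unitI {V R}.

(** * [arit] as a block derivation and [garit] as a composition *)

Section Flexions.
Variable L : fieldType.
Implicit Types (w u a b c : seq L) (M N S T A : mould L).

Lemma wsumE w : wsum w = wt w. Proof. by []. Qed.

Lemma minvP T : T [::] = 1 ->
  [/\ minv T [::] = 1, conv T (minv T) = onem & conv (minv T) T = onem].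
Proof.
move=> T1; have [U [U1 TU UT]] := conv_inv T1.
have [V1 TV] : in_GARI (minv T) /\ mmul T (minv T) = @mone L.
  exact: (epsilon_spec _ (fun W => in_GARI W /\ mmul T W = @mone L)
    (ex_intro _ U (conj U1 TU))).
by split=> //; rewrite -(conv_invK UT TV).
Qed.

Lemma rflex_cons x a b : a != [::] -> rflex (x :: a) b = x :: rflex a b.
Proof.
case/lastP: a => // a y _; rewrite /rflex rev_cons !rev_rcons /=.
by rewrite !rev_cons rev_rcons.
Qed.

Let leftsum N M w := \sum_(i < (size w).+1)
  \sum_(j < (size w).+1 | ((i < j) && (j < size w))%N)
      M (take i w ++ lflex (seg w i j) (drop j w)) * N (seg w i j).
Let rightsum N M w := \sum_(i < (size w).+1)
  \sum_(j < (size w).+1 | ((0 < i) && (i < j))%N)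
      M (rflex (take i w) (seg w i j) ++ drop j w) * N (seg w i j).

(** If the prefix before the [N]-block is empty, that block merges with the letter after it into one
    letter of their total weight, with coefficient [conv N unitI]. Otherwise [x] is untouched. *)
Let leftsum_cons N M x w : N [::] = 0 -> leftsum N M (x :: w) =
  leftsum N (lder x M) w + bind (conv N unitI) (fun v => lder v M) (x :: w).
Proof.
move=> N0; rewrite /leftsum big_ord_recl addrC; congr (_ + _).
  apply: eq_bigr => i _ /=; rewrite big_mkcond big_ord_recl /= add0r.
  by rewrite [RHS]big_mkcond; apply: eq_bigr => j _.
rewrite bindA {1}/bind big_mkcond; apply: eq_bigr => j _ /=.
rewrite /seg drop0 subn0; case: (posnP j) => [->|j_gt0].
  by rewrite take0 N0 mul0r.
have [lt_j|ge_j] := ltnP.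
  case E: (drop j (x :: w)) => [|y w'].
    by have := congr1 size E; rewrite size_drop /=; lia.
  by rewrite bind_unitI mulrC.
rewrite [drop j _]drop_oversize //.
by rewrite bind_nil mul0r mulr0.
Qed.

(** If the prefix is [x] alone, [x] and the [N]-block merge into one letter, with coefficient
    [conv unitI N]. A longer prefix leaves [x] untouched. *)
Let rightsum_cons N M x w : N [::] = 0 -> rightsum N M (x :: w) =
  rightsum N (lder x M) w + bind (conv unitI N) (fun v => lder v M) (x :: w).
Proof.
move=> N0; rewrite /rightsum big_ord_recl big_pred0 // add0r.
rewrite bindA bind_unitI big_ord_recl addrC [in RHS]big_ord_recl.
rewrite [X in _ = X + _ + _]big_pred0 // add0r; congr (_ + _).
  apply: eq_bigr => i _ /=; rewrite big_mkcond big_ord_recl /= add0r.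
  rewrite [RHS]big_mkcond; apply: eq_bigr => j _ /=.
  rewrite !/bump !leq0n !add1n !ltnS /=; case: ifP => // lt_ij.
  rewrite rflex_cons // -size_eq0 size_take_min.
  by move: (ltn_ord i) => /=; rewrite -/(size w); lia.
rewrite /bind big_mkcond big_ord_recl /= add0r; apply: eq_bigr => j _ /=.
rewrite !addn0 take0 /bump !add1n /seg /= drop0 subSS subn0 add0n.
case: (posnP j) => [->|j_gt0]; first by rewrite take0 N0 mul0r.
by rewrite ltnS j_gt0 mulrC /lder addrC.
Qed.

Lemma aritE N M : N [::] = 0 ->
  arit N M = der (subm (conv N unitI) (conv unitI N)) M.
Proof.
move=> N0; have -> : arit N M = fun w => leftsum N M w - rightsum N M w.
  apply: functional_extensionality => w; rewrite /arit; case: ifP => // w2.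
  by rewrite /leftsum /rightsum [X in X - _]big1 ?[X in _ - X]big1 ?subr0 //
    => i _; apply: big_pred0 => j; have := ltn_ord j; have := ltn_ord i; lia.
apply: functional_extensionality => w; elim: w M => [|x w IH] M.
  rewrite /leftsum /rightsum [X in X - _]big1 ?[X in _ - X]big1 ?subr0 //
    => i _; apply: big_pred0 => j; case: i j => [i lt_i] [j lt_j] /=;
    move: lt_i lt_j; rewrite /=; lia.
rewrite leftsum_cons // rightsum_cons // [RHS]/= -IH bindBl /subm; ring.
Qed.

(** * Resummation of the [garit] factorizations *)

Section GaritComposition.
Variables T T' : mould L.
Hypotheses (T1 : T [::] = 1) (T'1 : T' [::] = 1).

Let K := conv T (conv unitI T').
Let K0 : K [::] = 0.
Proof. by rewrite /K conv_nil unitI_conv_nil mulr0. Qed.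

(* When the flag f is set, the first block a_1 must be nonempty: this is the
   constraint left by an empty c before it. *)
Let blocks s (f : bool) S w := \sum_(p <- splits (3 * s) w |
    garit_ok s p && (f ==> ((s == 0%N) || (fa p 0 != [::]))))
  S (flatten [seq mflex (fa p i) (fb p i) (fc p i) | i <- iota 0 s])
   * (\prod_(i < s) T (fa p i)) * (\prod_(i < s) T' (fc p i)).

(** Since [T [::] = 1], subtracting the unit deletes exactly the empty a_1. *)
Let Tflag (f : bool) := if f then subm T onem else T.

(** The part of the sum that follows an a_1 of weight [v]: [j] and [k] are the lengths of b_1 and
    c_1, and [h] sums the remaining blocks, flagged when c_1 is empty. *)
Let tailsum (h : bool -> mould L -> mould L) S (v : L) w :=
  \sum_(j < (size w).+1 | (0 < j)%N) \sum_(k < (size (drop j w)).+1)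
    T' (take k (drop j w)) * h (k == 0%N :> nat)
      (fun u => S (rflex (if take j w is x :: b' then (v + x) :: b' else [::])
                   (take k (drop j w)) ++ u)) (drop k (drop j w)).

Let big_splits k w (P : pred (seq (seq L))) (F : seq (seq L) -> L) :
  \sum_(p <- splits k.+1 w | P p) F p =
  \sum_(i < (size w).+1) \sum_(p <- splits k (drop i w) | P (take i w :: p))
     F (take i w :: p).
Proof.
rewrite -[splits k.+1 w]/(flatten [seq [seq take i w :: p | p <- splits k (drop i w)]
  | i <- index_iota 0 (size w).+1]).
rewrite big_flatten big_map big_mkord.
by apply: eq_bigr => i _; rewrite big_map.
Qed.

Let faS a b c p i : fa (a :: b :: c :: p) i.+1 = fa p i.
Proof. by rewrite /fa mulnS. Qed.
Let fbS a b c p i : fb (a :: b :: c :: p) i.+1 = fb p i.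
Proof. by rewrite /fb mulnS. Qed.
Let fcS a b c p i : fc (a :: b :: c :: p) i.+1 = fc p i.
Proof. by rewrite /fc mulnS. Qed.

Let garit_okS s a b c p : garit_ok s.+1 (a :: b :: c :: p) =
  (b != [::]) && (garit_ok s p && ((c == [::]) ==> ((s == 0%N) || (fa p 0 != [::])))).
Proof.
rewrite /garit_ok /= -[1%N]addn0 iotaDl all_map.
rewrite (eq_all (a2 := fun i => fb p i != [::])); last by move=> i; rewrite /= fbS.
rewrite -[(b != [::]) && _ && _]andbA; congr (_ && _).
rewrite -andbA; congr (_ && _); case: s => [|s] /=; first by rewrite implybT.
rewrite -[1%N]addn0 iotaDl all_map faS andbC; congr (_ && _).
  by apply: eq_all => i; rewrite /= fcS faS.
by rewrite -!size_eq0 size_cat addn_eq0 negb_and; case: (size c == _).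
Qed.

Let blocksS s f S w : blocks s.+1 f S w =
  bind (Tflag f) (tailsum (blocks s) S) w.
Proof.
rewrite /blocks mulnS big_splits; apply: eq_bigr => i _.
rewrite big_splits /tailsum [in RHS]big_mkcond mulr_sumr /=.
apply: eq_bigr => j _; rewrite big_splits.
set a := take i w; set w1 := drop i w; set b := take j w1; set w2 := drop j w1.
case: (posnP j) => [j0|j_gt0].
  rewrite mulr0 big1 // => k _; apply: big_pred0 => p.
  by rewrite garit_okS /b j0 take0.
rewrite mulr_sumr; apply: eq_bigr => k _.
set c := take k w2; set w3 := drop k w2.
have b_n0 : b != [::].
  have le_j : (j <= size w1)%N by rewrite -ltnS; exact: (ltn_ord j).
  by rewrite -size_eq0 size_take_min (minn_idPl le_j) -lt0n.
have -> : (k == 0%N :> nat) = (c == [::]).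
  have le_k : (k <= size w2)%N by rewrite -ltnS; exact: (ltn_ord k).
  by rewrite -size_eq0 size_take_min (minn_idPl le_k).
rewrite mulrA mulr_sumr.
have TfE : Tflag f a = if f ==> (a != [::]) then T a else 0.
  by rewrite /Tflag; case: f a => -[|y a'] //=; rewrite /subm ?T1 /= ?subrr ?subr0.
have okE p : garit_ok s.+1 (a :: b :: c :: p) &&
      (f ==> ((s.+1 == 0%N) || (fa (a :: b :: c :: p) 0 != [::])))
    = (f ==> (a != [::])) &&
      (garit_ok s p && ((c == [::]) ==> ((s == 0%N) || (fa p 0 != [::])))).
  by rewrite garit_okS b_n0 andbC.
rewrite (eq_bigl _ _ okE) TfE; case: ifP => fa_ok; last first.
  by rewrite big_pred0 // big1 // => p _; rewrite !mul0r.
apply: eq_bigr => p _.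
rewrite !big_ord_recl /= -[1%N]addn0 iotaDl -map_comp.
rewrite (eq_map (g := fun i => mflex (fa p i) (fb p i) (fc p i))); last first.
  by move=> l; rewrite /= faS fbS fcS.
rewrite (eq_bigr (fun l : 'I_s => T (fa p l))) => [|l _]; last by rewrite faS.
rewrite [X in _ * (T' _ * X)](eq_bigr (fun l : 'I_s => T' (fc p l))) => [|l _];
  last by rewrite fcS.
rewrite -[rflex _ c]/(mflex a b c) -[fa (a :: _) 0]/a -[fc (a :: _) 0]/c.
ring.
Qed.

Let blocks0 f S w : blocks 0 f S w = if w is [::] then S [::] else 0.
Proof.
rewrite /blocks; case: w => [|x w]; last by rewrite big_nil.
by rewrite big_mkcond big_seq1 implybT !big_ord0 !mulr1.
Qed.

Let Kflag f := conv (Tflag f) (conv unitI T').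
Let target f S := addm (scm (S [::]) onem) (bind (Kflag f) (fun v => mcomp (lder v S) K)).

Let tailsum_nil h S v : tailsum h S v [::] = 0.
Proof. by rewrite /tailsum big_mkcond big_ord_recl /= big_ord0 addr0. Qed.

Let tailsum_cons h S v y w : tailsum h S v (y :: w) =
  bind T' (fun t => h false (lder (v + y + t) S)) w
  + (h true (lder (v + y) S) w - h false (lder (v + y) S) w)
  + tailsum h (lder (v + y) S) 0 w.
Proof.
rewrite {1}/tailsum big_mkcond big_ord_recl [X in X + _ = _]/= add0r big_ord_recl; congr (_ + _).
  rewrite /bind !big_ord_recl /= !take0 !drop0 T'1 !mul1r wt_nil addr0.
  rewrite [RHS]addrC addrA subrK /=; congr (_ + _).
    congr (h true _ w); apply: functional_extensionality => u.
    by rewrite /lder wsumE wt_nil add0r.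
  apply: eq_bigr => k _; congr (_ * h _ _ _).
  by apply: functional_extensionality => u; rewrite /rflex /= /lder addrC.
rewrite /tailsum [RHS]big_mkcond big_ord_recl [X in _ = X + _]/= add0r; apply: eq_bigr => j _ /=.
have j_n0 : take j.+1 w != [::].
  by rewrite -size_eq0 size_take_min (minn_idPl (ltn_ord j : (j < size w)%N)).
apply: eq_bigr => k _; congr (_ * h _ _ _).
apply: functional_extensionality => u; rewrite rflex_cons //= /lder.
by case: (take j.+1 w) j_n0 => //= z b _; rewrite add0r.
Qed.

(** A block b of length r stands for r one-letter blocks with empty c and a between them.
    Accordingly the correction [target true - target false] cancels the contribution of the longer
    b_1, and one letter followed by c_1 remains. *)
Let tailsum_target S v w : tailsum target S v w =
  bind (conv unitI T') (fun t => mcomp (lder (v + t) S) K) w.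
Proof.
have tfalse S' : target false S' = mcomp S' K by rewrite [RHS]compE.
elim: w S v => [|y w IH] S v.
  by rewrite tailsum_nil bind_nil unitI_conv_nil mul0r.
rewrite tailsum_cons IH [in RHS]bindA bind_unitI -addrA -[RHS]addr0; congr (_ + _).
  congr (bind _ _ w); apply: functional_extensionality => u.
  by rewrite tfalse addrA.
rewrite /target /addm /Kflag /= convBl conv1l bindBl /subm -/K.
rewrite (_ : (fun t => mcomp (lder (0 + t) _) K) = fun t => mcomp (lder t (lder (v + y) S)) K).
  ring.
by apply: functional_extensionality => u; rewrite add0r.
Qed.

Let blocks_sum n f S w : (size w <= n)%N ->
  \sum_(s < n.+1) blocks s f S w = target f S w.
Proof.
elim: n f S w => [|n IH] f S w le_w; rewrite big_ord_recl blocks0.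
  by case: w le_w => // _; rewrite big_ord0 /target /addm /scm bind_nil /Kflag
     conv_nil unitI_conv_nil mulr0 mul0r mulr1.
rewrite /target /addm; congr (_ + _).
  by case: (w) => [|y u]; rewrite /scm /= ?mulr1 ?mulr0.
rewrite /Kflag bindA.
under eq_bigr do rewrite blocksS.
rewrite /bind exchange_big /=; apply: eq_bigr => i _.
rewrite -mulr_sumr; congr (_ * _); rewrite -[RHS]tailsum_target /tailsum exchange_big.
rewrite /=; apply: eq_bigr => j j_gt0; rewrite exchange_big; apply: eq_bigr => k _ /=.
(* The remainder is strictly shorter than [w] because b_1 has length [j > 0]. *)
rewrite -mulr_sumr; congr (_ * _); apply: IH.
by have := size_drop j (drop i w); have := size_drop i w;
  have := size_drop k (drop j (drop i w)); lia.
Qed.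

Lemma garit_blocks S w : S [::] = 1 -> T' = minv T -> garit T S w = mcomp S K w.
Proof.
move=> S1 defT'; case: w => [|x w]; first by rewrite comp_nil S1.
have tfalse : target false S = mcomp S K by rewrite [RHS]compE.
rewrite -tfalse -(@blocks_sum (size (x :: w))) // big_ord_recl blocks0 add0r.
rewrite /garit big_mkcond big_ord_recl /= add0r; apply: eq_bigr => s _.
rewrite /blocks /=; apply: eq_big => [p|p _]; first by rewrite andbT.
by rewrite defT'.
Qed.

End GaritComposition.

Definition gkernel T := conv T (conv unitI (minv T)).

Lemma garitE T S : T [::] = 1 -> S [::] = 1 -> garit T S = mcomp S (gkernel T).
Proof.
move=> T1 S1; apply: functional_extensionality => w.
by have [V1 _ _] := minvP T1; apply: garit_blocks.
Qed.

End Flexions.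

(** * Infinitesimal right translation and its dependence on shorter words *)

Section Locality.
Variables (V : nmodType) (R : comNzRingType).
Implicit Types (w u : seq V) (M N F S T K A B D : seq V -> R).

(** Only blocks of length at least 2 are replaced, so [M] is evaluated on strictly shorter words. *)
Lemma der_local D D' M M' w : D [::] = 0 -> (forall x, D [:: x] = 0) ->
  (forall u, (size u <= size w)%N -> D u = D' u) ->
  (forall u, (size u < size w)%N -> M u = M' u) -> der D M w = der D' M' w.
Proof.
move=> D0 D1; elim: w M M' => [|x w IH] M M' eqD eqM //=.
congr (_ + _).
  by apply: IH => u lt_u; [apply: eqD; apply: leqW | apply: eqM].
apply: bind_eq_size => -[|[|k]] le_k.
- by rewrite take0 -eqD // D0 !mul0r.
- by rewrite /= take0 -eqD // D1 !mul0r.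
congr (_ * _); first by apply: eqD; rewrite size_take_min geq_minr.
by apply: eqM; rewrite /= size_drop; move: le_k => /=; lia.
Qed.

(** [arit(A)] is [der (adI A)], so [rho A] below is [preari(-, A)], the infinitesimal right
    translation in the group [gari]. *)
Definition adI A := subm (conv A unitI) (conv unitI A).
Definition rho A M := addm (der (adI A) M) (conv M A).

Lemma adI_nil A : A [::] = 0 -> adI A [::] = 0.
Proof. by move=> A0; rewrite /adI /subm !conv_nil A0 !(mulr0, mul0r) subrr. Qed.

Lemma adI1 A x : A [::] = 0 -> adI A [:: x] = 0.
Proof.
move=> A0; rewrite /adI /subm unitI_conv_cons conv_cons conv_nil A0.
by rewrite !(mulr0, mul0r) addr0 subrr.
Qed.

Lemma adI_local A A' w : A [::] = 0 -> A' [::] = 0 ->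
  (forall u, (size u < size w)%N -> A u = A' u) -> adI A w = adI A' w.
Proof.
move=> A0 A'0 eqA; case: w eqA => [|x w] eqA; first by rewrite !adI_nil.
rewrite /adI /subm !unitI_conv_cons eqA //; congr (_ - _).
apply: bind_eq_size => k le_k; have [lt_k|ge_k] := ltnP k (size (x :: w)).
  by rewrite eqA // size_takel.
by rewrite drop_oversize // !mulr0.
Qed.

Lemma rho_local A A' M M' w : A [::] = 0 -> A' [::] = 0 ->
  (forall u, (size u < size w)%N -> A u = A' u) ->
  (forall u, (size u < size w)%N -> M u = M' u) ->
  M [::] * A w = M' [::] * A' w -> rho A M w = rho A' M' w.
Proof.
move=> A0 A'0 eqA eqM eqMA; rewrite /rho /addm; congr (_ + _).
  apply: der_local => //; [exact: adI_nil|by move=> x; apply: adI1|].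
  by move=> u le_u; apply: adI_local => // v lt_v; apply: eqA; lia.
apply: bind_eq_size => -[|k] le_k; first by rewrite take0 drop0.
have lt : (size (drop k.+1 w) < size w)%N by rewrite size_drop; lia.
rewrite eqA //; case: (ltnP k.+1 (size w)) => [lt_k|ge_k].
  by rewrite eqM // size_takel.
by rewrite drop_oversize // A'0 !mulr0.
Qed.

Lemma der_zero D : der D zerom = zerom :> (seq V -> R).
Proof.
rewrite (_ : zerom = scm 0 zerom) ?der_scm; apply: functional_extensionality => u;
by rewrite /scm !mul0r.
Qed.

Lemma rho_add A M N : rho A (addm M N) = addm (rho A M) (rho A N).
Proof.
rewrite /rho der_add convDl; apply: functional_extensionality => w.
by rewrite /addm addrACA.
Qed.

Lemma rho_scm A c M : rho A (scm c M) = scm c (rho A M).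
Proof.
rewrite /rho der_scm /conv bindZl; apply: functional_extensionality => w.
by rewrite /addm /scm mulrDr.
Qed.

Lemma rho_vanish A M w : A [::] = 0 ->
  (forall u, (size u < size w)%N -> M u = 0) -> rho A M w = 0.
Proof.
move=> A0 M0; have z : rho A zerom = zerom.
  rewrite /rho der_zero /conv bind_zero.
  by apply: functional_extensionality => u; rewrite /addm addr0.
rewrite -[0]/(zerom w) -z; apply: rho_local => //.
case: w M0 => [|x w] M0; first by rewrite A0 !mulr0.
by rewrite M0.
Qed.

Lemma rho_conv A M N : A [::] = 0 ->
  rho A (conv M N) = addm (conv (der (adI A) M) N) (conv M (rho A N)).
Proof.
move=> A0; rewrite /rho der_conv ?adI_nil // convDr convA.
by apply: functional_extensionality => w; rewrite /addm addrA.
Qed.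

Lemma rho_one A : rho A onem = A.
Proof.
rewrite /rho der_one conv1l.
by apply: functional_extensionality => w; rewrite /addm add0r.
Qed.

(** The derivative of [unitI] is the commutator [adI A], which compensates exactly for exchanging
    right multiplication by [A] and by [unitI]. *)
Lemma rho_unitI A M : A [::] = 0 -> rho A (conv M unitI) = conv (rho A M) unitI.
Proof.
move=> A0; rewrite /rho der_conv ?adI_nil // der_unitI ?adI_nil //.
rewrite /adI convBr convDl !convA.
by apply: functional_extensionality => w; rewrite /addm /subm; ring.
Qed.

Lemma conv_cancelr M N S U : conv S U = onem -> conv M S = conv N S -> M = N.
Proof.
move=> SU MN; rewrite -(conv1r M) -(conv1r N) -SU -!convA.
by rewrite MN.
Qed.

(* Infinitesimal form of M (e^B S) = (M S) e^A in the group gari: here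
   M |-> (M o K) * S is right translation by S. *)
Lemma rho_intertwine A B M S U K : A [::] = 0 -> B [::] = 0 -> K [::] = 0 ->
  conv S U = onem -> conv K S = conv S unitI ->
  conv (mcomp B K) S = rho A S ->
  conv (mcomp (rho B M) K) S = rho A (conv (mcomp M K) S).
Proof.
move=> A0 B0 K0 SU KS BS.
(* Apply [rho A] to [K x S = S x I]. The right side becomes [(B o K) x S x I = (B o K) x K x S], and
   cancelling [S] gives the commutator of [B o K] and [K]. *)
have DK : der (adI A) K = mcomp (adI B) K.
  apply: (conv_cancelr SU); have E := rho_conv K S A0.
  rewrite KS rho_unitI // -BS convA -KS in E.
  rewrite /adI comp_sub // !comp_conv // comp_unitIl // convBl !convA E.
  by apply: functional_extensionality => w; rewrite /subm /addm addrK.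
rewrite rho_conv // /rho comp_add // (der_comp_conj M _ _ K0 DK) ?adI_nil //.
by rewrite comp_conv // convDl convA BS.
Qed.

End Locality.

(** * Base change of coefficients along a ring morphism *)

Section Functoriality.
Variables (V : nmodType) (R R' : comNzRingType) (f : {rmorphism R -> R'}).
Implicit Types (M N F S K D A : seq V -> R).

Definition mapm M : seq V -> R' := fun w => f (M w).

Lemma mapm_one : mapm onem = onem.
Proof.
by apply: functional_extensionality => -[|x w]; rewrite /mapm /= ?rmorph1 ?rmorph0.
Qed.

Lemma mapm_unitI : mapm unitI = unitI.
Proof.
by apply: functional_extensionality => -[|x [|y w]];
  rewrite /mapm /= ?rmorph1 ?rmorph0.
Qed.

Lemma mapm_bind F (G : V -> seq V -> R) :
  mapm (bind F G) = bind (mapm F) (fun v => mapm (G v)).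
Proof.
apply: functional_extensionality => w; rewrite /mapm /bind rmorph_sum /=.
by apply: eq_bigr => i _; rewrite rmorphM.
Qed.

Lemma mapm_conv M N : mapm (conv M N) = conv (mapm M) (mapm N).
Proof. exact: mapm_bind. Qed.

Lemma mapm_add M N : mapm (addm M N) = addm (mapm M) (mapm N).
Proof. by apply: functional_extensionality => w; rewrite /mapm /addm rmorphD. Qed.

Lemma mapm_sub M N : mapm (subm M N) = subm (mapm M) (mapm N).
Proof. by apply: functional_extensionality => w; rewrite /mapm /subm rmorphB. Qed.

Lemma mapm_comp S K : K [::] = 0 ->
  mapm (mcomp S K) = mcomp (mapm S) (mapm K).
Proof.
move=> K0; have K'0 : mapm K [::] = 0 by rewrite /mapm K0 rmorph0.
apply: functional_extensionality => w; elim/size_ind: w S => -[|x w] IH S //.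
rewrite [RHS]comp_cons // {1}/mapm comp_cons // -[LHS]/(mapm (bind _ _) _).
by rewrite mapm_bind; apply: bind_eq_short => // v u lt_u; rewrite IH.
Qed.

Lemma mapm_der D M : mapm (der D M) = der (mapm D) (mapm M).
Proof.
apply: functional_extensionality => w; elim: w M => [|x w IH] M.
  exact: rmorph0.
rewrite {1}/mapm /= rmorphD /=; congr (_ + _); first exact: (IH (lder x M)).
by rewrite -[LHS]/(mapm (bind _ _) _) mapm_bind.
Qed.

Lemma mapm_rho A M : mapm (rho A M) = rho (mapm A) (mapm M).
Proof. by rewrite /rho mapm_add mapm_der mapm_conv /adI mapm_sub !mapm_conv mapm_unitI. Qed.

End Functoriality.

(** * The group law of [gari] and the injectivity of [expari] *)

Section GariGroup.
Variable L : fieldType.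
Implicit Types (w u : seq L) (M N S T U K A B : mould L).

Lemma gkernel_nil T : gkernel T [::] = 0.
Proof. by rewrite /gkernel conv_nil unitI_conv_nil mulr0. Qed.

Lemma gkernel_tangent T : T [::] = 1 -> tangent_to_id (gkernel T).
Proof.
move=> T1; have [U1 _ _] := minvP T1; split=> [|x]; first exact: gkernel_nil.
rewrite /gkernel conv_cons T1 mul1r unitI_conv_cons U1 conv_nil unitI_conv_nil.
by rewrite mulr0 addr0.
Qed.

Lemma gkernel_conv T : T [::] = 1 -> conv (gkernel T) T = conv T unitI.
Proof. by move=> T1; have [_ _ UT] := minvP T1; rewrite /gkernel !convA UT conv1r. Qed.

Lemma gkernel_uniq T K : T [::] = 1 -> conv K T = conv T unitI -> K = gkernel T.
Proof.
move=> T1 KT; have [_ TU _] := minvP T1.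
by apply: (conv_cancelr TU); rewrite KT gkernel_conv.
Qed.

Lemma gariE S T : S [::] = 1 -> T [::] = 1 ->
  gari S T = conv (mcomp S (gkernel T)) T.
Proof. by move=> S1 T1; rewrite /gari garitE. Qed.

Lemma gari_nil S T : S [::] = 1 -> T [::] = 1 -> gari S T [::] = 1.
Proof. by move=> S1 T1; rewrite gariE // conv_nil comp_nil S1 T1 mulr1. Qed.

(** Compose [K_S x S = S x I] with [K_T], multiply by [T] and use [K_T x T = T x I]: the composite
    satisfies the equation characterising the kernel of [gari S T]. *)
Lemma gkernel_gari S T : S [::] = 1 -> T [::] = 1 ->
  gkernel (gari S T) = mcomp (gkernel S) (gkernel T).
Proof.
move=> S1 T1; apply/esym/gkernel_uniq; first exact: gari_nil.
have K0 := gkernel_nil T.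
rewrite gariE // -convA -comp_conv // gkernel_conv // comp_conv // comp_unitIl //.
by rewrite convA [RHS]convA gkernel_conv.
Qed.

Lemma gariA S T U : S [::] = 1 -> T [::] = 1 -> U [::] = 1 ->
  gari (gari S T) U = gari S (gari T U).
Proof.
move=> S1 T1 U1; have [KT KU] := (gkernel_nil T, gkernel_nil U).
rewrite [gari _ U]gariE ?gari_nil // [gari S (gari _ _)]gariE ?gari_nil //.
by rewrite gkernel_gari // [gari S T]gariE // [gari T U]gariE // comp_conv // mcompA // convA.
Qed.

Lemma gari_one S : S [::] = 1 -> gari S onem = S.
Proof.
move=> S1; rewrite gariE // conv1r -(@gkernel_uniq onem unitI) ?comp_unitIr //.
by rewrite conv1r conv1l.
Qed.

Lemma invgariP S : S [::] = 1 ->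
  invgari S [::] = 1 /\ gari S (invgari S) = onem.
Proof.
move=> S1; pose W := minv S; have [W1 SW WS] := minvP S1.
have [H [[H0 H1] KH _]] := comp_inv (gkernel_tangent S1).
(* With [H] the composition inverse of [K_S], the mould [S^-1 o H] has kernel [H], so [gari S T]
   becomes [(S x S^-1) o H = 1]. *)
pose T := mcomp W H; have T1 : T [::] = 1 by rewrite /T comp_nil.
have KT : gkernel T = H.
  apply/esym/gkernel_uniq => //.
  rewrite /T -KH -comp_conv // -{1}(comp_unitIl H0) -comp_conv //.
  by rewrite /gkernel -convA WS conv1l.
apply: (epsilon_spec _ (fun T => in_GARI T /\ gari S T = @mone L)).
exists T; split=> //; rewrite gariE // KT /T -comp_conv // SW comp_one //.
Qed.

Lemma preariE M A : A [::] = 0 -> preari M A = rho A M.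
Proof. by move=> A0; rewrite /preari aritE. Qed.

Lemma preari_powE A k : A [::] = 0 -> preari_pow A k = iter k (rho A) onem.
Proof.
move=> A0; elim: k => // -[|k] IH; first by rewrite /= rho_one.
by rewrite iterS -IH -preariE.
Qed.

Lemma expari_nil A : expari A [::] = 1.
Proof. by rewrite /expari big_ord_recl big_ord0 addr0 /= fact0 invr1 mulr1. Qed.

Lemma iter_rho_nil A k : A [::] = 0 -> iter k.+1 (rho A) onem [::] = 0.
Proof. by move=> A0; rewrite iterS /rho /addm conv_nil A0 mulr0 addr0. Qed.

Lemma expari_cons A x w : A [::] = 0 -> expari A (x :: w) = A (x :: w) +
  \sum_(i < size w) (i.+2`!%:R)^-1 * iter i.+2 (rho A) onem (x :: w).
Proof.
move=> A0; rewrite /expari big_ord_recl mulr0 add0r big_ord_recl.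
rewrite [preari_pow A _]/= (_ : _`!%:R = 1) // invr1 mul1r; congr (_ + _).
by apply: eq_bigr => i _; rewrite preari_powE.
Qed.

(** On a word of length m, [expari A] is [A] plus terms that depend on [A] in lengths below m
    only. *)
Lemma expari_inj A B : A [::] = 0 -> B [::] = 0 -> expari A = expari B -> A = B.
Proof.
move=> A0 B0 eqE; apply: functional_extensionality => w.
elim/size_ind: w => -[|x w] IH; first by rewrite A0 B0.
have iter_eq k u : (size u < size (x :: w))%N ->
    iter k.+1 (rho A) onem u = iter k.+1 (rho B) onem u.
  elim: k u => [|k IHk] u lt_u; first by rewrite /= !rho_one IH.
  apply: (rho_local (M := iter k.+1 (rho A) onem) (M' := iter k.+1 (rho B) onem))
    => // [v lt_v|v lt_v|]; [exact: IH (ltn_trans lt_v lt_u)|exact: IHk (ltn_trans lt_v lt_u)|].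
  by rewrite !iter_rho_nil // !mul0r.
have := congr1 (fun M => M (x :: w)) eqE; rewrite !expari_cons //.
rewrite (eq_bigr (fun i : 'I_(size w) =>
  (i.+2`!%:R)^-1 * iter i.+2 (rho B) onem (x :: w))); first exact: addIr.
move=> i _; congr (_ * _).
apply: (rho_local (M := iter i.+1 (rho A) onem) (M' := iter i.+1 (rho B) onem))
  => // [v lt_v|].
  exact: iter_eq.
by rewrite !iter_rho_nil // !mul0r.
Qed.

Lemma logariP A : A [::] = 0 -> logari (expari A) = A.
Proof.
move=> A0.
have [L0 eqE] : in_ARI (logari (expari A)) /\ expari (logari (expari A)) = expari A.
  apply: (epsilon_spec _ (fun B => in_ARI B /\ expari B = expari A)).
  by exists A.
exact: expari_inj.
Qed.

End GariGroup.

(** * Flows of [expari] and the adjoint action *)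

(* The one-parameter subgroups t |-> expari (t A) are handled as functions on
   words with values in {poly L}, the polynomial variable being the time t. *)
Section Exponential.
Variable L : fieldType.
Hypothesis char0 : forall n, n.+1%:R != 0 :> L.
Implicit Types (w u : seq L) (A B S T K : mould L) (E M N X Y : seq L -> {poly L}).

Definition ddt M : seq L -> {poly L} := fun w => (M w)^`().
Definition constm (S : mould L) : seq L -> {poly L} := mapm (@polyC L) S.
Definition at_time (c : L) M : mould L := mapm (horner_eval c) M.

Lemma at_timeK c S : at_time c (constm S) = S.
Proof.
by apply: functional_extensionality => w;
  rewrite /at_time /constm /mapm /= /horner_eval hornerC.
Qed.

Lemma ddt_const S : ddt (constm S) = zerom.
Proof. by apply: functional_extensionality => w; rewrite /ddt derivC. Qed.

Lemma ddt_bind F G : ddt (bind F G) = addm (bind (ddt F) G) (bind F (fun v => ddt (G v))).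
Proof.
apply: functional_extensionality => w.
rewrite /ddt /addm /bind raddf_sum -big_split /=.
by apply: eq_bigr => i _; rewrite derivM.
Qed.

Lemma ddt_conv M N : ddt (conv M N) = addm (conv (ddt M) N) (conv M (ddt N)).
Proof. exact: ddt_bind. Qed.

Lemma ddt_comp_const M K : K [::] = 0 ->
  ddt (mcomp M (constm K)) = mcomp (ddt M) (constm K).
Proof.
move=> K0; have K'0 : constm K [::] = 0 by rewrite /constm /mapm K0.
apply: functional_extensionality => w; elim/size_ind: w M => -[|x w] IH M //.
rewrite [RHS]comp_cons // {1}/ddt comp_cons // -[LHS]/(ddt (bind _ _) _).
rewrite ddt_bind ddt_const bind_zero /addm add0r.
by apply: bind_eq_short => // v u lt_u; rewrite IH.
Qed.

Lemma ddt_comp (D K : seq L -> {poly L}) S : D [::] = 0 -> K [::] = 0 -> ddt K = der D K ->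
  ddt (mcomp (constm S) K) = der D (mcomp (constm S) K).
Proof.
move=> D0 K0 dK; apply: functional_extensionality => w.
elim/size_ind: w S => -[|x w] IH S; first by rewrite /ddt comp_nil derivC.
rewrite [in RHS]compE // der_add der_scm der_one der_bind // {1}/ddt comp_cons //.
rewrite -[LHS]/(ddt (bind _ _) _) ddt_bind dK /addm /scm mulr0 add0r.
congr (_ + _); apply: bind_eq_short => // v u lt_u.
exact: (IH _ lt_u (lder v S)).
Qed.

(** By induction on the length, [rho] agrees on [X] and [Y], so their difference has zero time
    derivative. In characteristic zero it is constant, and it vanishes at time 0. *)
Lemma ode_uniq A X Y : A [::] = 0 -> ddt X = rho (constm A) X ->
  ddt Y = rho (constm A) Y -> at_time 0 X = at_time 0 Y -> X = Y.
Proof.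
move=> A0 dX dY XY0; have A'0 : constm A [::] = 0 by rewrite /constm /mapm A0.
apply: functional_extensionality => w; elim/size_ind: w => w IH.
have d0 : (X w - Y w)^`() = 0.
  rewrite derivB -[(X w)^`()]/(ddt X w) -[(Y w)^`()]/(ddt Y w) dX dY.
  apply/eqP; rewrite subr_eq0; apply/eqP; apply: rho_local => //.
  by case: w IH => [|x w] IH; rewrite ?A'0 ?mulr0 // IH.
apply/eqP; rewrite -subr_eq0; apply/eqP/polyP => -[|i]; rewrite coef0.
  rewrite -horner_coef0 hornerD hornerN.
  have := congr1 (fun S => S w) XY0; rewrite /at_time /mapm /= /horner_eval => ->.
  exact: subrr.
have /eqP := congr1 (fun p : {poly L} => p`_i) d0.
by rewrite coef_deriv coef0 -mulr_natr mulf_eq0 (negbTE (char0 i)) orbF => /eqP.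
Qed.

Section Flow.
Variable A : mould L.
Hypothesis A0 : A [::] = 0.

Let A'0 : constm A [::] = 0.
Proof. by rewrite /constm /mapm A0. Qed.

Let term k : seq L -> {poly L} :=
  scm ((k`!%:R^-1)%:P * 'X^k) (constm (iter k (rho A) onem)).
Let trunc n : seq L -> {poly L} := fun w => \sum_(k < n) term k w.

(** The series of [expari(t A)], cut where its terms begin to vanish, hence polynomial in t on each
    word. *)
Definition flow : seq L -> {poly L} := fun w => trunc (size w).+1 w.

Let iter_vanish k w : (size w < k)%N -> iter k (rho A) onem w = 0.
Proof.
elim: k w => // k IH w lt_w; rewrite iterS; apply: rho_vanish => // u lt_u.
by apply: IH; apply: leq_trans lt_u _.
Qed.

Let flow_trunc n w : (size w < n)%N -> flow w = trunc n w.
Proof.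
move=> lt_n; rewrite /flow /trunc -(subnKC lt_n) big_split_ord /=.
rewrite [X in _ + X]big1 ?addr0 // => i _.
by rewrite /term /scm /constm /mapm iter_vanish ?mulr0 // ltn_addr.
Qed.

Let ddt_trunc n : ddt (trunc n.+1) = rho (constm A) (trunc n).
Proof.
elim: n => [|n IH].
  rewrite (_ : trunc 0 = scm 0 zerom); last first.
    by apply: functional_extensionality => w; rewrite /trunc big_ord0 /scm mul0r.
  rewrite rho_scm; apply: functional_extensionality => w.
  by rewrite /ddt /trunc big_ord1 /term /scm mul0r expr0 mulr1 -polyCM derivC.
have truncS m : trunc m.+1 = addm (trunc m) (term m).
  by apply: functional_extensionality => w; rewrite /trunc big_ord_recr.
rewrite [in RHS]truncS rho_add -IH rho_scm.
rewrite -[rho _ (constm _)](mapm_rho (@polyC L)) truncS.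
apply: functional_extensionality => w; rewrite /ddt /addm derivD; congr (_ + _).
rewrite /term /scm /constm /mapm -iterS derivM derivC mulr0 addr0; congr (_ * _).
rewrite derivM derivC mul0r add0r derivXn /= mulrnAr -mulrnAl; congr (_ * _).
by rewrite -polyCMn factS natrM invfM -[X in X%:P = _]mulr_natl mulrA mulfV ?mul1r.
Qed.

Lemma ddt_flow : ddt flow = rho (constm A) flow.
Proof.
apply: functional_extensionality => w.
(* Differentiation lowers the truncation order by one, so one extra term is kept. *)
rewrite {1}/ddt (@flow_trunc (size w).+2) // -[LHS]/(ddt (trunc _) w) ddt_trunc.
apply: rho_local => // [u lt_u|]; first by rewrite (@flow_trunc (size w).+1) // ltnS ltnW.
by rewrite (@flow_trunc (size w).+1 [::]).
Qed.

Lemma flow_nil : flow [::] = 1.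
Proof.
by rewrite /flow /trunc big_ord1 /term /scm /constm /mapm expr0 !mulr1 fact0 invr1.
Qed.

Lemma flow0 : at_time 0 flow = onem.
Proof.
apply: functional_extensionality => w.
rewrite /at_time /mapm /= /horner_eval /flow /trunc horner_sum big_ord_recl.
rewrite big1 => [|i _]; rewrite /term /scm /constm /mapm /=.
  by rewrite expr0 mulr1 -polyCM hornerC fact0 invr1 mul1r addr0.
by rewrite !hornerM hornerXn expr0n /= mulr0 mul0r.
Qed.

Lemma flow1 : at_time 1 flow = expari A.
Proof.
apply: functional_extensionality => w.
rewrite /at_time /mapm /= /horner_eval /flow /trunc horner_sum.
apply: eq_bigr => i _; rewrite /term /scm /constm /mapm /= !hornerM !hornerC hornerXn expr1n mulr1.
by rewrite preari_powE.
Qed.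

End Flow.

(** The curves [gari S (expari(t A))] and [gari (expari(t B)) S] solve the same equation
    [ddt X = rho A X] and both start at [S]; they are compared at t = 1. *)
Lemma gari_expari_conj S A B : S [::] = 1 -> A [::] = 0 -> B [::] = 0 ->
  conv (mcomp B (gkernel S)) S = rho A S ->
  gari S (expari A) = gari (expari B) S.
Proof.
move=> S1 A0 B0 BS.
have A'0 : constm A [::] = 0 by rewrite /constm /mapm A0.
have K0 := gkernel_nil S; have [_ SU US] := minvP S1.
have [EU [EU1 EEU EUE]] := conv_inv (flow_nil A).
pose E := flow A; pose K := conv E (conv unitI EU).
have K_0 : K [::] = 0 by rewrite /K conv_nil unitI_conv_nil mulr0.
have KE : conv K E = conv E unitI by rewrite /K !convA EUE conv1r.
have dI : ddt unitI = zerom by rewrite -(mapm_unitI _ (@polyC L)) ddt_const.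
(* Differentiate [K x E = E x I] in time and compare with the image of the same identity under
   [rho A]. *)
have dK : ddt K = der (adI (constm A)) K.
  apply: (conv_cancelr EEU); have := congr1 ddt KE.
  rewrite !ddt_conv dI ddt_flow // -[flow A]/E.
  rewrite conv_zeror addm_zeror.
  rewrite -rho_unitI // -KE rho_conv // => eqA.
  apply: functional_extensionality => u.
  by have := congr1 (fun M => M u) eqA; rewrite /addm => /addIr.
pose X := conv (mcomp (constm S) K) E.
pose Y := conv (mcomp (flow B) (constm (gkernel S))) (constm S).
have Xc c : at_time c X = conv (mcomp S (at_time c K)) (at_time c E).
  by rewrite /X /at_time mapm_conv mapm_comp // -[mapm _ (constm S)]/(at_time c _) at_timeK.
have Yc c : at_time c Y = conv (mcomp (at_time c (flow B)) (gkernel S)) S.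
  rewrite /Y /at_time mapm_conv mapm_comp -?[mapm _ (constm _)]/(at_time c _) ?at_timeK //.
  by rewrite /constm /mapm K0.
have KEc c : conv (at_time c K) (at_time c E) = conv (at_time c E) unitI.
  by rewrite /at_time -mapm_conv KE mapm_conv mapm_unitI.
suff XY : X = Y.
  have := Xc 1; rewrite XY Yc !flow1 // -gariE ?expari_nil // => ->.
  rewrite gariE ?expari_nil // -(@gkernel_uniq _ _ (at_time 1 K)) ?expari_nil //.
  by have := KEc 1; rewrite flow1.
apply: (ode_uniq A0).
- rewrite /X ddt_conv rho_conv // (ddt_comp S _ K_0 dK) ?adI_nil //.
  by rewrite ddt_flow.
- rewrite /Y ddt_conv ddt_const ddt_comp_const // ddt_flow //.
  rewrite conv_zeror addm_zeror.
  apply: (@rho_intertwine _ _ _ _ _ _ (constm (minv S))); rewrite /constm.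
  + exact: A'0.
  + by rewrite /mapm B0.
  + by rewrite /mapm K0.
  + by rewrite -mapm_conv SU mapm_one.
  + by rewrite -mapm_conv gkernel_conv // mapm_conv mapm_unitI.
  + by rewrite -mapm_comp // -mapm_conv BS mapm_rho.
- rewrite Xc Yc !flow0 // comp_one // conv1l.
  have := KEc 0; rewrite flow0 // conv1r conv1l => ->.
  by rewrite comp_unitIr conv1r.
Qed.

(* adari(S) is the adjoint action of S, hence conjugates the infinitesimal
   right translation by A into the left one. *)
Lemma adari_spec S A : S [::] = 1 -> A [::] = 0 ->
  conv (mcomp (adari S A) (gkernel S)) S = rho A S.
Proof.
move=> S1 A0; have [_ SU US] := minvP S1; have K0 := gkernel_nil S.
have [H [[H0 _] _ HK]] := comp_inv (gkernel_tangent S1).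
(* The required equation solved for [B]: divide by [S] on the right, then compose with the inverse
   of [gkernel S]. *)
pose B := mcomp (conv (rho A S) (minv S)) H.
have B0 : B [::] = 0.
  by rewrite /B comp_nil conv_nil /rho /addm conv_nil A0 mulr0 addr0 mul0r.
have BS : conv (mcomp B (gkernel S)) S = rho A S.
  by rewrite /B mcompA // HK comp_unitIr convA US conv1r.
suff -> : adari S A = B by [].
have [T1 ST] := invgariP S1.
rewrite /adari (gari_expari_conj S1 A0 B0 BS) gariA ?expari_nil // ST.
by rewrite gari_one ?expari_nil // logariP.
Qed.

End Exponential.

(** * Multiplication by a function of the total weight *)

Section Weight.
Variables (V : nmodType) (R : comNzRingType).
Implicit Types (w u : seq V) (M N F S K D : seq V -> R).

Definition wmul (g : V -> R) M : seq V -> R := fun w => g (wt w) * M w.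

Lemma lder_wmul g x M : lder x (wmul g M) = wmul (fun v => g (x + v)) (lder x M).
Proof. by apply: functional_extensionality => w; rewrite /lder /wmul wt_cons. Qed.

Lemma bind_wmul g F (G : V -> seq V -> R) :
  bind F (fun v => wmul (fun y => g (v + y)) (G v)) = wmul g (bind F G).
Proof.
apply: functional_extensionality => w; rewrite /wmul /bind mulr_sumr.
by apply: eq_bigr => i _; rewrite -wt_cat cat_take_drop mulrCA.
Qed.

(** Merging letters into blocks preserves the total weight; the same reason gives [der_wmul]. *)
Lemma comp_wmul g S K : K [::] = 0 -> mcomp (wmul g S) K = wmul g (mcomp S K).
Proof.
move=> K0; apply: functional_extensionality => w.
elim/size_ind: w g S => -[|x w] IH g S //.
rewrite {2}/wmul !comp_cons // -[RHS]/(wmul g (bind _ _) _) -bind_wmul.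
by apply: bind_eq_short => // v u lt_u; rewrite lder_wmul IH.
Qed.

Lemma der_wmul g D M : der D (wmul g M) = wmul g (der D M).
Proof.
apply: functional_extensionality => w.
elim: w g M => [|x w IH] g M; first by rewrite /wmul mulr0.
rewrite [LHS]/= lder_wmul IH.
rewrite (_ : (fun v => lder v (wmul g M)) =
  fun v => wmul (fun y => g (v + y)) (lder v M)); last first.
  by apply: functional_extensionality => v; rewrite lder_wmul.
by rewrite bind_wmul /wmul [der D M (x :: w)]/= mulrDr wt_cons.
Qed.

End Weight.

(** * Moulds supported on words of length one *)

Section Letters.
Variables (V : nmodType) (R : comNzRingType).
Implicit Types (w : seq V) (M S K : seq V -> R).

Lemma conv_unitI_rcons M w x : conv M unitI (rcons w x) = M w.
Proof.
elim: w M => [|y w IH] M /=.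
  by rewrite conv_cons conv_nil mulr0 addr0 mulr1.
by rewrite conv_cons IH (_ : unitI _ = 0) ?mulr0 ?add0r //; case: w {IH}.
Qed.

Lemma conv_unitI_nil M : conv M unitI [::] = 0.
Proof. by rewrite conv_nil mulr0. Qed.

Definition letter (f : V -> R) : seq V -> R := fun w => if w is [:: x] then f x else 0.

Lemma lder_letter f x : lder x (letter f) = scm (f x) onem.
Proof.
by apply: functional_extensionality => -[|y u]; rewrite /scm /lder /= ?mulr1 ?mulr0.
Qed.

(** Only the grouping of [w] into a single block survives. *)
Lemma letter_comp f K w : K [::] = 0 -> mcomp (letter f) K w = f (wt w) * K w.
Proof.
move=> K0; rewrite compE // /addm /scm mul0r add0r -[RHS]/(wmul f K w).
rewrite -[X in wmul f X]conv1r -bind_wmul; congr (bind _ _ w).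
apply: functional_extensionality => v.
rewrite lder_letter comp_scm // comp_one //.
apply: functional_extensionality => -[|x u];
  by rewrite /scm /wmul /= ?mulr1 ?mulr0 ?wt_nil ?addr0.
Qed.

Lemma conv_letter f A B w : conv (conv A (letter f)) B w =
  \sum_(i < size w) A (take i w) * f (nth 0 w i) * B (drop i.+1 w).
Proof.
elim: w A => [|x w IH] A; first by rewrite !conv_nil mulr0 mul0r big_ord0.
rewrite conv_cons conv_nil mulr0 mul0r add0r big_ord_recl /= drop0.
rewrite {1}/conv lder_bind bindDl bindZl -/(conv _ _) -/(conv _ _) /addm /scm IH.
congr (_ + _); rewrite -mulrA; congr (_ * _).
by rewrite lder_letter /conv bindZl bind_onel.
Qed.

End Letters.

(** * Equality of moulds away from vanishing denominators *)

Section GoodWords.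
Variables (L : fieldType) (good : L -> Prop).
Hypotheses (goodD : forall x y, good x -> good y -> good (x + y))
           (good0 : ~ good 0).
Implicit Types (w u : seq L) (M N F S T K D : mould L).

Definition goodw w := forall x, x \in w -> good x.
(** Since [0^-1 = 0], identities with denominators may fail on arbitrary words. As [good] is closed
    under addition, it contains the weights of all nonempty blocks, so this relation is compatible
    with product, composition and [der]. *)
Definition eqg M N := forall w, goodw w -> M w = N w.

Lemma goodw_take k w : goodw w -> goodw (take k w).
Proof. by move=> gw x /mem_take; apply: gw. Qed.
Lemma goodw_drop k w : goodw w -> goodw (drop k w).
Proof. by move=> gw x /mem_drop; apply: gw. Qed.
Lemma goodw_cons x w : good x -> goodw w -> goodw (x :: w).
Proof. by move=> gx gw y; rewrite inE => /orP[/eqP -> //|]; apply: gw. Qed.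
Lemma goodw_behead x w : goodw (x :: w) -> goodw w.
Proof. by move=> gw y yw; apply: gw; rewrite inE yw orbT. Qed.
Lemma goodw_head x w : goodw (x :: w) -> good x.
Proof. by apply; rewrite inE eqxx. Qed.

Lemma goodw_wt w : goodw w -> w != [::] -> good (wt w).
Proof.
elim: w => // x [|y w] IH gw _; first by rewrite wt_cons wt_nil addr0; apply: goodw_head gw.
by rewrite wt_cons; apply: goodD; [apply: goodw_head gw|apply: IH (goodw_behead gw) _].
Qed.

Lemma goodw_wt_neq0 w : goodw w -> w != [::] -> wt w != 0.
Proof. by move=> gw w0; apply/eqP => E; apply: good0; rewrite -E; apply: goodw_wt. Qed.

Lemma eqg_trans M N T : eqg M N -> eqg N T -> eqg M T.
Proof. by move=> MN NT w gw; rewrite MN ?NT. Qed.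

Lemma eqg_sym M N : eqg M N -> eqg N M.
Proof. by move=> MN w gw; rewrite MN. Qed.

Lemma conv_eqg M M' N N' : eqg M M' -> eqg N N' -> eqg (conv M N) (conv M' N').
Proof.
move=> MM NN w gw; apply: bind_eq_size => k _.
by rewrite MM ?NN //; [apply: goodw_drop | apply: goodw_take].
Qed.

Lemma bind_eqg K K' (G G' : L -> mould L) : K [::] = 0 -> eqg K K' ->
  (forall v, good v -> eqg (G v) (G' v)) -> eqg (bind K G) (bind K' G').
Proof.
move=> K0 KK GG w gw; have K'0 : K' [::] = 0 by rewrite -KK.
apply: bind_eq_size => -[|k] le_k; first by rewrite take0 K0 K'0 !mul0r.
have gt := goodw_take (k := k.+1) gw; rewrite KK // GG //; last exact: goodw_drop.
by apply: goodw_wt => //; case: (w) le_k.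
Qed.

Lemma lder_eqg v M M' : good v -> eqg M M' -> eqg (lder v M) (lder v M').
Proof. by move=> gv MM w gw; apply: MM; apply: goodw_cons. Qed.

Lemma comp_eqg S S' K K' : K [::] = 0 -> eqg S S' -> eqg K K' ->
  eqg (mcomp S K) (mcomp S' K').
Proof.
move=> K0 SS KK w; have K'0 : K' [::] = 0 by rewrite -KK.
elim/size_ind: w S S' SS => -[|x w] IH S S' SS gw; first by rewrite !comp_nil SS.
rewrite !comp_cons //; apply: bind_eq_size => -[|k] le_k.
  by rewrite take0 K0 K'0 !mul0r.
have gt := goodw_take (k := k.+1) gw; rewrite KK //; congr (_ * _); apply: IH.
- by rewrite size_drop; move: le_k => /=; lia.
- by apply: lder_eqg => //; apply: goodw_wt.
- exact: goodw_drop.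
Qed.

Lemma der_eqg D M M' : D [::] = 0 -> eqg M M' -> eqg (der D M) (der D M').
Proof.
move=> D0 MM w; elim: w M M' MM => // x w IH M M' MM gw /=.
have gx := goodw_head gw.
rewrite (IH _ (lder x M')); [|exact: lder_eqg|exact: goodw_behead gw].
by congr (_ + _); apply: bind_eqg gw => // v gv; apply: lder_eqg.
Qed.

End GoodWords.

(** * Differential equations for [paj] and the explicit adjoint action *)

Section PajIdentity.
Variable L : fieldType.
Implicit Types (w u : seq L) (M N F S T K D : mould L).

Definition nabla M : mould L := wmul id M.

Lemma nabla_conv M N : nabla (conv M N) = addm (conv (nabla M) N) (conv M (nabla N)).
Proof.
apply: functional_extensionality => w.
rewrite /nabla /addm /wmul /conv /bind mulr_sumr -big_split /=.
apply: eq_bigr => i _; rewrite -{1}(cat_take_drop i w) wt_cat; ring.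
Qed.

Lemma comp_nabla S K : K [::] = 0 -> mcomp (nabla S) K = nabla (mcomp S K).
Proof. exact: comp_wmul. Qed.

Lemma der_nabla D M : der D (nabla M) = nabla (der D M).
Proof. exact: der_wmul. Qed.

Lemma wt_nth w : wt w = \sum_(i < size w) nth 0 w i.
Proof. by rewrite /wt (big_nth 0) big_mkord. Qed.

Lemma paj_nil : paj ([::] : seq L) = 1.
Proof. by rewrite /paj big_ord0. Qed.

Lemma paj_rcons w x : paj (rcons w x) = paj w * (wt (rcons w x))^-1.
Proof.
rewrite /paj size_rcons big_ord_recr /=; congr (_ * _^-1).
  apply: eq_bigr => i _; congr (_^-1); apply: eq_bigr => j _.
  by rewrite nth_rcons ifT //; have := ltn_ord j; have := ltn_ord i; lia.
by rewrite wt_nth size_rcons.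
Qed.

Lemma nabla_paj w : wt w != 0 -> nabla (@paj L) w = conv (@paj L) unitI w.
Proof.
case/lastP: w => [|w x]; first by rewrite wt_nil eqxx.
by move=> wt0; rewrite conv_unitI_rcons /nabla /wmul paj_rcons mulrCA mulfV ?mulr1.
Qed.

Lemma wt_opp w : wt (map -%R w) = - wt w.
Proof. by rewrite /wt big_map sumrN. Qed.

Lemma mneg_conv M N : mneg (conv M N) = conv (mneg M) (mneg N).
Proof.
apply: functional_extensionality => w; rewrite /mneg /conv /bind size_map.
by apply: eq_bigr => i _; rewrite map_take map_drop.
Qed.

Lemma mneg_unitI : mneg unitI = @unitI L L.
Proof. by apply: functional_extensionality => -[|x [|y w]]. Qed.

Lemma mneg_one : mneg onem = @onem L L.
Proof. by apply: functional_extensionality => -[|x w]. Qed.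

(** Closed form of the inverse of [paj]: on good words it solves [nabla V = - I x V]. *)
Fixpoint pajinv w : L := if w is x :: u then (- wt w)^-1 * pajinv u else 1.

Let S := @paj L.
Let U := minv S.
Let K := gkernel S.
Let Km := mneg K.

Let S1 : S [::] = 1. Proof. exact: paj_nil. Qed.
Let SU : conv S U = onem. Proof. by have [] := minvP S1. Qed.
Let US : conv U S = onem. Proof. by have [] := minvP S1. Qed.
Let U1 : U [::] = 1. Proof. by have [] := minvP S1. Qed.
Let K0 : K [::] = 0. Proof. exact: gkernel_nil. Qed.
Let KS : conv K S = conv S unitI. Proof. exact: gkernel_conv. Qed.
Let Km0 : Km [::] = 0. Proof. exact: K0. Qed.

Section Good.
Variable good : L -> Prop.
Hypotheses (goodD : forall x y, good x -> good y -> good (x + y))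
           (good0 : ~ good 0).

Let refl M : eqg good M M. Proof. by []. Qed.

Let nablaS : eqg good (nabla S) (conv S unitI).
Proof.
case=> [|x w] gw; first by rewrite conv_unitI_nil /nabla /wmul wt_nil mul0r.
by apply: nabla_paj; apply: goodw_wt_neq0 gw _.
Qed.

Let nablaSm : eqg good (nabla (mneg S)) (scm (-1) (conv (mneg S) unitI)).
Proof.
case=> [|x w] gw; first by rewrite /scm conv_unitI_nil /nabla /wmul wt_nil mul0r mulr0.
have wt0 : wt (x :: w) != 0 by apply: goodw_wt_neq0 gw _.
rewrite -mneg_unitI -mneg_conv /scm {2}/mneg -nabla_paj ?wt_opp ?oppr_eq0 //.
by rewrite /nabla /wmul wt_opp mulN1r mulNr opprK.
Qed.

(* A solution of nabla T = 0 is constant. *)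
Let nabla_zero T : T [::] = 1 -> eqg good (nabla T) zerom -> eqg good T onem.
Proof.
move=> T1 nT [|x w] gw //=; have := nT _ gw; rewrite /nabla /wmul /= => /eqP.
by rewrite mulf_eq0 (negbTE (goodw_wt_neq0 _ _ gw _)) // => /eqP.
Qed.

Let comp_Sm : eqg good (mcomp (mneg S) K) U.
Proof.
have T1 : eqg good (conv (mcomp (mneg S) K) S) onem.
  apply: nabla_zero; first by rewrite conv_nil comp_nil /mneg S1 mulr1.
  rewrite nabla_conv -comp_nabla // => w gw; rewrite /addm.
  rewrite (conv_eqg (comp_eqg goodD K0 nablaSm (refl K)) (refl S)) //.
  rewrite (conv_eqg (refl (mcomp (mneg S) K)) nablaS) //.
  rewrite comp_scm // comp_conv // comp_unitIl // /conv bindZl -/(conv _ _).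
  by rewrite -!/(conv _ _) /scm convA KS mulN1r addNr.
rewrite -[mcomp _ _]conv1r -SU -convA -{2}[U]conv1l.
exact: conv_eqg.
Qed.

(** Composing the factors of [Km = neg S x I x neg U] with [K] gives [U], [K] and [S], and
    [U x K x S = U x S x I = I]. *)
Let comp_Km : eqg good (mcomp Km K) unitI.
Proof.
have KmE : Km = conv (mneg S) (conv unitI (mneg U)).
  by rewrite -mneg_unitI -!mneg_conv.
have comp_Um : eqg good (mcomp (mneg U) K) S.
  set P := mcomp _ _; have SmP : conv (mcomp (mneg S) K) P = onem.
    by rewrite -comp_conv // -mneg_conv SU mneg_one comp_one.
  have -> : P = conv S (conv U P) by rewrite -convA SU conv1l.
  apply: (@eqg_trans _ _ _ (conv S (conv (mcomp (mneg S) K) P))).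
    by apply: conv_eqg => //; apply: conv_eqg => //; apply: eqg_sym.
  by rewrite SmP conv1r.
rewrite KmE !comp_conv // comp_unitIl //.
apply: (@eqg_trans _ _ _ (conv U (conv K S))).
  by apply: conv_eqg => //; apply: conv_eqg.
by rewrite KS -convA US conv1l.
Qed.

(** [nabla (S x pajinv) = S x I x pajinv - S x I x pajinv = 0], so this product is the unit. *)
Lemma minv_paj : eqg good U pajinv.
Proof.
have np : eqg good (nabla pajinv) (scm (-1) (conv unitI pajinv)).
  case=> [|x w] gw; rewrite /nabla /wmul /scm.
    by rewrite wt_nil unitI_conv_nil mul0r mulr0.
  rewrite unitI_conv_cons [pajinv (_ :: _)]/= invrN mulrA mulrN mulfV //.
  exact: goodw_wt_neq0 gw _.
have T1 : eqg good (conv S pajinv) onem.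
  apply: nabla_zero; first by rewrite conv_nil S1 mulr1.
  rewrite nabla_conv => w gw; rewrite /addm.
  rewrite (conv_eqg nablaS (refl pajinv)) // (conv_eqg (refl S) np) //.
  rewrite /conv bindZr -!/(conv _ _) /scm convA mulN1r; exact: subrr.
have -> : pajinv = conv U (conv S pajinv) by rewrite -convA US conv1l.
by rewrite -[X in eqg _ X _]conv1r; apply: eqg_sym; apply: conv_eqg.
Qed.

Variable f : L -> L.
Let s : mould L := letter f.
Let G := mcomp s Km.

Definition saj : mould L := conv (conv (minv (@paj L)) (letter f)) (@paj L).

(* nabla^-1 of (nabla G + G x I - I x G). *)
Definition adari_saj : mould L := fun w =>
  G w + (wt w)^-1 * (conv G unitI w - conv unitI G w).

Let comp_G : eqg good (mcomp G K) s.
Proof.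
rewrite /G mcompA // -[X in eqg _ _ X]comp_unitIr.
by apply: comp_eqg => //; rewrite comp_nil.
Qed.

Let nabla_Q : eqg good (nabla adari_saj)
  (addm (nabla G) (subm (conv G unitI) (conv unitI G))).
Proof.
case=> [|x w] gw; rewrite /nabla /addm /wmul /subm.
  by rewrite wt_nil !mul0r conv_unitI_nil unitI_conv_nil subrr addr0.
rewrite /adari_saj mulrDr mulrA mulfV ?mul1r //.
exact: goodw_wt_neq0 gw _.
Qed.

Let comp_nabla_Q : eqg good (mcomp (nabla adari_saj) K)
  (addm (nabla s) (subm (conv s K) (conv K s))).
Proof.
apply: eqg_trans (comp_eqg goodD K0 nabla_Q (refl K)) _.
rewrite comp_add // comp_sub // !comp_conv // comp_unitIl // comp_nabla //.
move=> w gw; rewrite /addm /subm (conv_eqg comp_G (refl K)) //.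
rewrite (conv_eqg (refl K) comp_G) //; congr (_ + _).
by rewrite /nabla /wmul comp_G.
Qed.

Let s0 : s [::] = 0. Proof. by []. Qed.

Let saj0 : saj [::] = 0.
Proof. by rewrite /saj !conv_nil mulr0 mul0r. Qed.

Let S_saj : conv S saj = conv s S.
Proof. by rewrite /saj -!convA SU conv1l. Qed.

Let nabla_uniq T : T [::] = 0 -> eqg good (nabla T) (conv T unitI) -> eqg good T zerom.
Proof.
move=> T0 nT w; elim/last_ind: w => [|w x IH] gw; first exact: T0.
have wn0 : wt (rcons w x) != 0 by apply: (goodw_wt_neq0 goodD good0 gw); case: (w).
have := nT _ gw; rewrite conv_unitI_rcons IH; last first.
  by move=> y yw; apply: gw; rewrite mem_rcons inE yw orbT.
by move/eqP; rewrite /nabla /wmul mulf_eq0 (negbTE wn0) => /eqP.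
Qed.

(** The difference [Z] of the two sides satisfies [nabla Z = Z x I] and vanishes on the empty word;
    reading off last letters, it is zero. *)
Lemma rho_saj : eqg good (rho saj S) (conv (mcomp adari_saj K) S).
Proof.
have := S_saj; have := saj0; move: saj => N N0 S_N.
set Z2 := conv _ S; pose X := der (adI N) S.
have D0 := adI_nil N0.
(* Apply the derivation to [nabla S = S x I], then use [S x N = s x S] and
   [S x I x N = K x S x N = K x s x S]. *)
have nX : eqg good (nabla X) (addm (conv X unitI)
    (subm (conv (conv s S) unitI) (conv (conv K s) S))).
  rewrite /X -der_nabla; apply: eqg_trans (der_eqg goodD D0 nablaS) _.
  rewrite der_conv // der_unitI // {2}/adI convBr -!convA S_N.
  by rewrite -KS [conv (conv K S) _]convA S_N !convA.
have nZ2 : eqg good (nabla Z2) (addm (conv Z2 unitI)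
    (conv (addm (nabla s) (subm (conv s K) (conv K s))) S)).
  rewrite /Z2 nabla_conv -comp_nabla // => w gw.
  rewrite /addm addrC convA (conv_eqg (refl _) nablaS) //; congr (_ + _).
  exact: (conv_eqg comp_nabla_Q (refl S)).
have nsS : eqg good (nabla (conv s S)) (addm (conv (nabla s) S) (conv (conv s S) unitI)).
  rewrite nabla_conv => w gw; rewrite /addm convA; congr (_ + _).
  exact: (conv_eqg (refl s) nablaS).
have ZE : rho N S = addm X (conv s S) by rewrite /rho S_N.
suff : eqg good (subm (rho N S) Z2) zerom.
  by move=> E w gw; apply/eqP; rewrite -subr_eq0; apply/eqP; apply: E.
apply: nabla_uniq => [|w gw].
  rewrite /subm /rho /addm /Z2 !conv_nil comp_nil N0 mulr0 addr0 /adari_saj /G.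
  by rewrite comp_nil conv_unitI_nil unitI_conv_nil subrr mulr0 addr0 mul0r subrr.
rewrite convBl ZE convDl; move: (nX _ gw) (nZ2 _ gw) (nsS _ gw).
rewrite convDl convBl.
rewrite (_ : conv (conv s K) S = conv (conv s S) unitI); last by rewrite [LHS]convA KS -convA.
rewrite /nabla /wmul /addm /subm => e1 e2 e3.
rewrite mulrBr mulrDr e1 e2 e3; ring.
Qed.

Hypothesis char0 : forall n, n.+1%:R != 0 :> L.

(** [adari_spec] and [rho_saj] give the same equation for both moulds, and [S] and [K] can be
    cancelled because they are invertible for product and composition. *)
Lemma adari_paj : eqg good (adari S saj) adari_saj.
Proof.
have [H [[H0 _] KH _]] := comp_inv (gkernel_tangent S1).
suff E : eqg good (mcomp (adari S saj) K) (mcomp adari_saj K).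
  rewrite -[adari _ _]comp_unitIr -[adari_saj]comp_unitIr -KH -!mcompA //.
  by apply: comp_eqg.
rewrite -[mcomp _ _]conv1r -[X in eqg _ _ X]conv1r -SU -!convA adari_spec //.
exact: conv_eqg rho_saj (refl U).
Qed.

End Good.
End PajIdentity.

(** * Brown's element in terms of [paj] and its inverse on blocks *)

Section BrownElement.
Variable L : fieldType.
Implicit Types (w u : seq L).

Definition block w i j := drop i (take j w).

Lemma wt_block w i j : (i <= j)%N -> wt (block w i j) = wt (take j w) - wt (take i w).
Proof.
move=> le_ij; rewrite -[in RHS](cat_take_drop i (take j w)) take_takel //.
by rewrite wt_cat addrC addKr.
Qed.

Lemma pajinv_block w i j : (i <= j)%N -> (j <= size w)%N ->
  pajinv (block w i j) =
  (\prod_(a <- iota i (j - i)) (wt (take a w) - wt (take j w)))^-1.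
Proof.
move=> le_ij le_j; have [k] := ubnP (j - i); elim: k i le_ij => // k IH i le_ij lt_k.
move: (le_ij); rewrite leq_eqVlt => /orP[/eqP ->|lt_ij].
  by rewrite subnn big_nil invr1 /block drop_oversize // size_take_min geq_minl.
have bE : block w i j = nth 0 w i :: block w i.+1 j.
  by rewrite /block -(nth_take 0 lt_ij) -drop_nth // size_takel.
have lt_k' : (j - i.+1 < k)%N by rewrite -ltnS subnSK.
rewrite bE [LHS]/= -bE wt_block // opprB IH //.
by rewrite -(subnSK lt_ij) /= big_cons invfM.
Qed.

Lemma paj_block w i j : (i <= j)%N -> (j <= size w)%N ->
  paj (block w i j) =
  (\prod_(a <- iota i.+1 (j - i)) (wt (take a w) - wt (take i w)))^-1.
Proof.
move=> le_ij; elim: j le_ij => [|j IH].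
  by rewrite leqn0 => /eqP -> _; rewrite big_nil invr1 /block take0 paj_nil.
rewrite leq_eqVlt => /orP[/eqP ->|lt_ij] le_j.
  by rewrite subnn big_nil invr1 /block drop_oversize ?paj_nil // size_takel.
have bE : block w i j.+1 = rcons (block w i j) (nth 0 w j).
  rewrite /block (take_nth 0) // -cats1 drop_cat size_takel ?(ltnW le_j) //.
  case: ltnP => ge_ji; first by rewrite cats1.
  have [-> ->] : i = j /\ drop i (take j w) = [::].
    by split; [lia|rewrite drop_oversize // size_takel // ltnW].
  by rewrite subnn drop0.
rewrite bE paj_rcons -bE IH //; last exact: ltnW.
rewrite wt_block ?(ltnW lt_ij) // subSn // -[(j - i).+1]addn1 iotaD big_cat big_seq1.
by rewrite addSn subnKC // invfM mulrC.
Qed.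

Lemma nth_psums w k : (k < size w)%N -> nth 0 (psums w) k = wt (take k.+1 w).
Proof.
move=> lt_k; rewrite /psums (nth_map 0) ?size_iota // nth_iota // add0n wt_nth.
rewrite size_takel //; apply: eq_bigr => j _.
by rewrite nth_take.
Qed.

Definition xdiff (x : nat -> L) (A B : seq nat) :=
  \prod_(a <- A) \prod_(b <- B) (x a - x b).

(* psi with the points x_0 = 0, x_1, ..., x_d given as a function. *)
Definition psi_points n d (x : nat -> L) :=
  2%:R^-1 * \sum_(1 <= i < d.+1)
     ( (x i - x i.-1) ^+ (2 * n)
        / (xdiff x (rng 0 i.-1) [:: i.-1] * xdiff x (rng i.+1 d.+1) [:: i])
     + x d ^+ (2 * n) / (xdiff x (rng 1 i) [:: 0%N] * xdiff x (rng i d) [:: d]) )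
  - 2%:R^-1 * \sum_(1 <= i < d)
     ( (x 1%N - x d) ^+ (2 * n)
        / (xdiff x (rng 2 i.+1) [:: 1%N] * xdiff x (rng i.+1 d ++ [:: 0%N]) [:: d])
     + x d.-1 ^+ (2 * n)
        / (xdiff x (d :: rng 1 i) [:: 0%N] * xdiff x (rng i d.-1) [:: d.-1]) ).

Lemma psiE n (xs : seq L) :
  psi n xs = psi_points n (size xs) (fun k => if k == 0%N then 0 else nth 0 xs k.-1).
Proof. by []. Qed.

(** On good words this is [neg (s o neg K_S)]: the power is the even letter mould [s] at the weight
    of [w], the sum is [paj x I x paj^-1]. *)
Definition psi_kernel n w : L := wt w ^+ (2 * n) *
  \sum_(i < size w) paj (take i w) * pajinv (drop i.+1 w).

(** At partial sums, each denominator of [psi] is a product of block weights up to sign, as in [paj]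
    and [pajinv] of blocks. The four sums match the four terms in order. *)
Lemma psi_psums n w : (0 < size w)%N -> psi n (psums w) = 2%:R^-1 *
  (\sum_(i < size w) pajinv (take i w) * nth 0 w i ^+ (2 * n) * paj (drop i.+1 w)
   + (psi_kernel n w
      + (wt w)^-1 * (psi_kernel n (behead w) - psi_kernel n (take (size w).-1 w)))).
Proof.
set d := size w => d_gt0; rewrite psiE.
rewrite (_ : size (psums w) = d); last by rewrite size_map size_iota.
set x := fun k => if k == 0%N then 0 else nth 0 (psums w) k.-1.
pose y k := wt (take k w).
have xE k : (k <= d)%N -> x k = y k.
  rewrite /x /y; case: k => [|k] le_k; first by rewrite take0 wt_nil.
  by rewrite nth_psums.
(* Every index occurring in [psi] is at most [d], so [xE] is all that has to be kept of [x]. *)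
clearbody x; rewrite /psi_points.
have y0 : y 0%N = 0 by rewrite /y take0 wt_nil.
have yd : y d = wt w by rewrite /y take_size.
have yS k : (k < d)%N -> y k.+1 - y k = nth 0 w k.
  move=> lt_k; rewrite /y (take_nth 0) // -cats1 wt_cat wt_cons wt_nil addr0.
  by rewrite [LHS]addrC addKr.
have xprod A b : (b <= d)%N -> (forall a, a \in A -> (a <= d)%N) ->
    xdiff x A [:: b] = \prod_(a <- A) (y a - y b).
  move=> le_b le_A; apply: eq_big_seq => a aA.
  by rewrite big_seq1 !xE // le_A.
have take_blk k : take k w = block w 0 k by rewrite /block drop0.
have drop_blk k : drop k w = block w k d by rewrite /block take_size.
rewrite big_add1 big_mkord /= big_add1 big_mkord -mulrBr; congr (_ * _).
rewrite !big_split /= -addrA; congr (_ + _).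
  apply: eq_bigr => i _; have lt_i : (i < d)%N := ltn_ord i.
  rewrite !xE ?(ltnW lt_i) // !xprod ?(ltnW lt_i) //; try by move=> a;
    rewrite mem_iota; lia.
  rewrite take_blk pajinv_block ?(ltnW lt_i) // drop_blk paj_block //.
  rewrite invfM [RHS]mulrAC mulrC /rng subSS; congr (_ * _).
  by rewrite yS.
congr (_ + _).
  rewrite /psi_kernel mulr_sumr.
  apply: eq_bigr => i _; have lt_i : (i < d)%N := ltn_ord i.
  rewrite xE // yd !xprod //; try by move=> a; rewrite mem_iota; lia.
  rewrite take_blk paj_block ?(ltnW lt_i) // drop_blk pajinv_block //.
  by rewrite invfM /rng subn1 subn0.
rewrite mulrBr opprD; congr (_ + _).
  rewrite /psi_kernel size_behead -/d mulrA mulr_sumr -sumrN.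
  apply: eq_bigr => i _; have lt_i : (i < d.-1)%N := ltn_ord i.
  have -> : take i (behead w) = block w 1 i.+1 by rewrite -drop1 /block take_drop addn1.
  have -> : drop i.+1 (behead w) = block w i.+2 d.
    by rewrite -drop1 drop_drop addn1 drop_blk.
  rewrite !xE // !xprod //; try by move=> a; rewrite ?mem_cat ?inE mem_iota; lia.
  rewrite paj_block ?pajinv_block //; try lia.
  (* The extra point 0 contributes [y 0 - y d = - wt w]; its sign turns the subtracted sum into a
     positive term. *)
  rewrite big_cat big_seq1 /= -/(y 0%N) y0 sub0r /rng.
  have -> : y 1%N - y d = - wt (behead w).
    rewrite yd /y; case: (w) (d_gt0 : (0 < size w)%N) => // z u _ /=.
    by rewrite take0 !wt_cons wt_nil addr0 opprD addNKr.
  have -> : (i.+2 - 2 = i.+1 - 1)%N by lia.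
  rewrite exprM sqrrN -exprM -yd !(invfM, invrN, mulrN) opprK.
  ring.
rewrite /psi_kernel size_takel ?leq_pred // mulrA mulr_sumr; congr (- _).
apply: eq_bigr => i _; have lt_i : (i < d.-1)%N := ltn_ord i.
have -> : take i (take d.-1 w) = block w 0 i by rewrite take_takel ?take_blk // ltnW.
rewrite -/(block w i.+1 d.-1) -/(y d.-1).
rewrite !xE ?leq_pred // !xprod ?leq_pred //; try by move=> a;
  rewrite ?inE mem_iota; lia.
rewrite paj_block ?pajinv_block //; try lia.
(* Here the extra point [d] contributes [y d - y 0 = wt w], so the minus sign stays. *)
rewrite big_cons y0 !subr0 -/(y 0%N) y0 yd /rng subn1 subn0 !invfM.
ring.
Qed.

End BrownElement.

Lemma sang_sa (L : fieldType) (char0 : forall k, k.+1%:R != 0 :> L)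
    (good : L -> Prop) (n : nat) (w : seq L) :
  (forall x y, good x -> good y -> good (x + y)) -> ~ good 0 -> goodw good w ->
  sang (sa n) w = 2%:R^-1 *
  (\sum_(i < size w) pajinv (take i w) * nth 0 w i ^+ (2 * n) * paj (drop i.+1 w)
   + (psi_kernel n w
      + (wt w)^-1 * (psi_kernel n (behead w) - psi_kernel n (take (size w).-1 w)))).
Proof.
move=> goodD good0 gw; pose f (u : L) := u ^+ (2 * n).
have fN u : f (- u) = f u by rewrite /f exprM sqrrN -exprM.
have minvE := minv_paj goodD good0.
(* Evaluating at the negated word undoes the [mneg] on the kernel, and the even power absorbs the
   sign of the weight. *)
have kernelE u : goodw good u ->
    mcomp (letter f) (mneg (gkernel (@paj L))) (map -%R u) = psi_kernel n u.
  move=> gu; rewrite letter_comp; last exact: gkernel_nil.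
  rewrite wt_opp fN {1}/mneg mapK; last exact: opprK.
  rewrite /psi_kernel /gkernel -convA; congr (_ * _).
  rewrite (@conv_letter _ _ (fun => 1)); apply: eq_bigr => i _.
  by rewrite mulr1 minvE //; apply: goodw_drop.
rewrite /sang /mscale /madd; congr (_ * (_ + _)).
  rewrite [LHS](@conv_letter _ _ f); apply: eq_bigr => i _.
  by rewrite minvE //; apply: goodw_take.
(* The outer [mneg] evaluates [adari] at the negated word, so the explicit formula is applied with
   the set of negatives of good elements. *)
have gNw : goodw (fun x => good (- x)) (map -%R w).
  by move=> x /mapP[y yw ->]; rewrite opprK; apply: gw.
have gND x y : good (- x) -> good (- y) -> good (- (x + y)).
  by rewrite opprD; apply: goodD.
have gN0 : ~ good (- 0) by rewrite oppr0.
rewrite {1}/mneg [LHS](adari_paj gND gN0 f char0 gNw) /adari_saj kernelE //.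
(* The sign of the negated weight exchanges the two terms: [I x G] drops the first letter and
   [G x I] the last one. *)
congr (_ + _); rewrite wt_opp invrN mulNr -mulrN opprB; congr (_ * (_ - _)).
  case: (w) gw => [|x u] gw /=; last by rewrite unitI_conv_cons kernelE //; apply: goodw_behead gw.
  by rewrite unitI_conv_nil /psi_kernel big_ord0 mulr0.
case/lastP: (w) gw => [|u x] gw; first by rewrite conv_unitI_nil /psi_kernel big_ord0 mulr0.
rewrite map_rcons conv_unitI_rcons size_rcons -cats1 take_size_cat //.
by rewrite kernelE // => y yu; apply: gw; rewrite mem_rcons inE yu orbT.
Qed.

(** * The generic variables form a good word *)

Section GenericVariables.
Variable d : nat.
Let P := {mpoly rat[d]}.

Definition positive_at_one (x : {fraction P}) :=
  exists p : P, x = tofrac p /\ 0 < p.@[fun => 1].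

Lemma positive_at_oneD x y :
  positive_at_one x -> positive_at_one y -> positive_at_one (x + y).
Proof.
move=> [p [-> p1]] [q [-> q1]]; exists (p + q).
by rewrite tofracD mevalD addr_gt0.
Qed.

Lemma positive_at_one0 : ~ positive_at_one 0.
Proof.
move=> [p [/esym/eqP]]; rewrite tofrac_eq0 => /eqP ->.
by rewrite meval0 ltxx.
Qed.

Lemma genvars_positive : goodw positive_at_one (genvars d).
Proof.
by move=> x /mapP[i _ ->]; exists 'X_i; rewrite mevalXU ltr01.
Qed.

Lemma fraction_char0 k : k.+1%:R != 0 :> {fraction P}.
Proof.
rewrite -(rmorph_nat (@tofrac P)) tofrac_eq0; apply/eqP => E.
have := congr1 (fun p : P => p.@[fun => 1]) E.
by rewrite meval0 rmorph_nat => /eqP; rewrite pnatr_eq0.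
Qed.

End GenericVariables.

Theorem theorem2p7 (n d : nat) : (1 <= n)%N -> (1 <= d)%N ->
  psi n (psums (genvars d)) = sang (sa n) (genvars d).
Proof.
move=> _ d_gt0; rewrite psi_psums; last by rewrite size_map size_enum_ord.
by rewrite (sang_sa (@fraction_char0 d) _ (@positive_at_oneD d) (@positive_at_one0 d)
  (@genvars_positive d)).
Qed.
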